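(* Let $\Delta$ be a simplicial complex on a finite set $V$ with $|V|=n$, and let $\varsigma=(v_1,\dots,v_n)$ be a linear ordering of $V$. Then $$\mu_1^\varsigma(\Delta)-\mu_0^\varsigma(\Delta)\ \geq\ m(\Delta)-b_0(\Delta).$$ In particular, if $\Delta$ is connected, then $\mu_1(\Delta)-\mu_0(\Delta)+1\geq m(\Delta)$.
   Context: A simplicial complex on $V$ is a collection of subsets of $V$ closed under inclusion. For $W\subseteq V$, $\Delta_W=\{F\in\Delta: F\subseteq W\}$. The link of $F\in\Delta$ is $\mathrm{lk}(F,\Delta)=\{G\in\Delta: F\cup G\in\Delta, F\cap G=\emptyset\}$; it is void if $F\notin\Delta$. $b_0(\Delta)$ is the number of connected components of $\Delta$. $\tilde b_i(\Delta)$ is the dimension of the $i$th reduced simplicial homology of $\Delta$ over a field (so $\tilde b_{-1}(\{\emptyset\})=1$, and all $\tilde b_i$ of the void complex are $0$); only $i=-1,0$ are used below, for which it does not depend on the field. Let $\mathcal{S}_V$ be the set of linear orderings of $V$. For $\varsigma=(v_1,\dots,v_n)\in\mathcal{S}_V$ and $i\in\{0,1\}$, $$\mu_i^\varsigma(\Delta)=\sum_{k=1}^n\tilde b_{i-1}\big(\mathrm{lk}(v_k,\Delta_{\{v_1,\dots,v_k\}})\big),\qquad \mu_i(\Delta)=\frac1{n!}\sum_{\varsigma\in\mathcal{S}_V}\mu_i^\varsigma(\Delta).$$ For connected $\Delta$, $m(\Delta)$ is the minimum number of generators of the fundamental group of the geometric realization of $\Delta$. For arbitrary $\Delta$, $m(\Delta)$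 is the sum of the $m$-numbers of the connected components of $\Delta$ (so $m(\{\emptyset\})=0$). *)

(* Defs.v *)
From mathcomp Require Import all_boot all_order all_algebra.

Set Implicit Arguments.
Unset Strict Implicit.
Unset Printing Implicit Defensive.

Import Order.TTheory GRing.Theory Num.Theory.

Local Open Scope ring_scope.

Section Complex.
Variable V : finType.
Implicit Types (D : {set {set V}}) (W : {set V}).

Definition simplicial_complex D :=
  forall A B : {set V}, A \in D -> B \subset A -> B \in D.

Definition induced D W : {set {set V}} := [set A in D | A \subset W].

(* When D is closed under inclusion and A is not a face, this is void. *)
Definition link (A : {set V}) D : {set {set V}} :=
  [set B in D | (A :|: B \in D) && (A :&: B == set0)].

Definition vertices D : {set V} := [set v : V | [set v] \in D].

Definition edge D : rel V := [rel u v | [set u; v] \in D].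

(* The restriction to [vertices D] matters: a point of V which is not a vertex
   of D is a connected component of the graph [edge D], but not of D. *)
Definition b0 D : nat := n_comp (edge D) (vertices D).

Definition component D (v : V) : {set {set V}} :=
  induced D [set u | connect (edge D) v u].

(* Any two vertices are joined by a path; this includes the complex {set0}. *)
Definition connected_complex D :=
  {in vertices D &, forall u v, connect (edge D) u v}.

End Complex.

Section Homology.
Variables (F : fieldType) (V : finType).
Implicit Types (D : {set {set V}}) (i : int).

(* faces D (-1) is {set0} or empty; faces D i is empty for i < -1. *)
Definition faces D i : {set {set V}} :=
  [set A in D | #|A|%:Z == i + 1].

(* If A = {v_0 < ... < v_i} for the order enum_rank on V, this is (-1)^j when
   B = A \ {v_j}, and 0 when B is not a facet of A. *)
Definition incidence (A B : {set V}) : F :=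
  \sum_(v in A | B == A :\ v)
    (-1) ^+ #|[set u in A | (enum_rank u < enum_rank v)%N]|.

(* The boundary map from i-chains to (i-1)-chains of the augmented oriented
   chain complex of D, acting on row vectors. *)
Definition boundary D i : 'M[F]_(#|faces D i|, #|faces D (i - 1)|) :=
  \matrix_(a, b) incidence (enum_val a) (enum_val b).

(* dim (ker boundary_i) - dim (im boundary_(i+1)) *)
Definition reduced_betti D i : nat :=
  (\rank (kermx (boundary D i)) - \rank (boundary D (i + 1)))%N.

Definition mu_order (s : #|V|.-tuple V) D i : nat :=
  (\sum_(k < #|V|)
    reduced_betti (link [set tnth s k] (induced D [set v in take k.+1 s]))
      (i - 1)%R)%N.

End Homology.

From mathcomp Require Import all_classical all_reals all_analysis.
Import numFieldNormedType.Exports.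
Local Open Scope classical_set_scope.
Local Open Scope ring_scope.

Definition mu (R : realType) (F : fieldType) (V : finType)
    (D : {set {set V}}) (i : int) : R :=
  ((#|V|)`!)%:R^-1 * \sum_(s : #|V|.-tuple V | uniq s) (mu_order F s D i)%:R.

Section FundamentalGroup.
Variables (R : realType) (T : topologicalType) (X : set T) (x0 : T).
Implicit Types (f g h : R -> T).

(* Only the values on [0, 1] matter. *)
Definition loop f :=
  [/\ {within `[0, 1]%classic, continuous f},
      f @` `[0, 1]%classic `<=` X, f 0 = x0 & f 1 = x0].

Definition loop_concat f g : R -> T :=
  fun t => if t <= 2^-1 then f (2 * t) else g (2 * t - 1).

Definition loop_rev f : R -> T := fun t => f (1 - t).

Definition unit_square : set (R * R) := `[0, 1]%classic `*` `[0, 1]%classic.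

Definition loop_homotopic f g :=
  exists H : R * R -> T,
    [/\ {within unit_square, continuous H}, H @` unit_square `<=` X,
        forall s : R, 0 <= s <= 1 -> H (s, 0) = f s,
        forall s : R, 0 <= s <= 1 -> H (s, 1) = g s &
        forall t : R, 0 <= t <= 1 -> H (0, t) = x0 /\ H (1, t) = x0].

Definition loop_class f : set (R -> T) :=
  [set g | loop g /\ loop_homotopic f g].

(* The group pi_1(X, x0): its carrier and its operations. *)
Definition pi1 : set (set (R -> T)) := [set loop_class f | f in loop].

Definition pi1_one : set (R -> T) := loop_class (fun=> x0).

Definition pi1_mul (a b : set (R -> T)) : set (R -> T) :=
  [set h | exists f g, [/\ a f, b g & loop_class (loop_concat f g) h]].

Definition pi1_inv (a : set (R -> T)) : set (R -> T) :=
  [set h | exists2 f, a f & loop_class (loop_rev f) h].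

Definition pi1_subgroup (G : set (set (R -> T))) :=
  [/\ G `<=` pi1, G pi1_one,
      forall a b, G a -> G b -> G (pi1_mul a b) &
      forall a, G a -> G (pi1_inv a)].

Definition pi1_generated_by (S : set (set (R -> T))) :=
  S `<=` pi1 /\ forall G, pi1_subgroup G -> S `<=` G -> G = pi1.

(* The value is +oo if the group is not finitely generated. *)
Definition pi1_rank : \bar R :=
  ereal_inf [set (k%:R)%:E | k in [set k : nat |
    exists S : 'I_k -> set (R -> T), pi1_generated_by (range S)]].

End FundamentalGroup.

Section Realization.
Variables (R : realType) (V : finType).
Implicit Types D : {set {set V}}.

(* The point of barycentric coordinates (x_v) is the row vector whose entry at
   index enum_rank v is x_v. *)
Definition realization D : set 'rV[R]_#|V| :=
  [set x | [/\ forall j, 0 <= x ord0 j, \sum_j x ord0 j = 1 &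
               [set v | x ord0 (enum_rank v) != 0]%SET \in D]].

Definition vertex_point (v : V) : 'rV[R]_#|V| := delta_mx ord0 (enum_rank v).

(* One summand per connected component, based at the vertex of the component
   that represents it in [b0]. *)
Definition m_number D : \bar R :=
  (\sum_(v in [predI roots (edge D) & vertices D])
    @pi1_rank R _ (realization (component D v)) (vertex_point v))%E.

End Realization.

(* Main.v *)
(** Add the vertices in the given order, and join each new vertex to one vertex
    in each connected component of its lower link.  The resulting graph [K] has
    the vertices of the complex [D], and the difference of its numbers of edges
    and vertices is the sum over the vertices of [b0 (lower link) - 1], which is
    at most [mu_1 - mu_0].  By induction along the order, every edge of [D] is
    homotopic in [D] to a walk in [K]: an edge to the lower link slides, across
    triangles, along a path of the link to the chosen vertex of its component.
    Hence [K] has the same components as [D], and the fundamental group of a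
    component is generated by the loops of the edges of [K] outside a spanning
    tree, since every loop is homotopic to an edge path.  Only this generation
    statement is needed, so that van Kampen's theorem is avoided.  Summing
    (edges - vertices + 1) over the components gives the bound. *)

Require Import Defs.
From mathcomp Require Import all_boot all_order all_algebra.
From mathcomp Require Import zify.

Set Implicit Arguments.
Unset Strict Implicit.
Unset Printing Implicit Defensive.

Import Order.TTheory GRing.Theory Num.Theory.

(** * Walks up to homotopy *)

Section Walks.
Variables (V : finType) (D : {set {set V}}).
Hypothesis hD : simplicial_complex D.

(** Generation is stated as a closure principle for predicates on closed walks: a predicate that
    contains the empty walk and the generators and is stable under concatenation, reversal and
    [walk_eq] holds for every closed walk. Membership of the class of a walk in a subgroup of the
    fundamental group is such a predicate, so no edge-path group is formed and the combinatorial
    part never meets topology. The two sides touch where a loop is sampled: some coordinate of each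
    point is at least [1/|V|], and it stays nonzero while coordinates change by less than that, so
    consecutive samples select the ends of an edge or a repeated vertex. The kept edges are pairs
    directed from the later vertex to the earlier one, hence none is counted twice. On the
    homological side, the indicators of the components are annihilated by the edge boundary, which
    bounds its rank from above and so the zeroth reduced Betti number from below. *)

Definition closed_walk (a : V) (p : seq V) :=
  path (edge D) a p && (last a p == a).

(* Edge paths up to homotopy: the triangle move is realized by a straight-line
   homotopy inside a simplex of [D], the stutter by a reparametrization. *)
Inductive walk_eq (a : V) : seq V -> seq V -> Prop :=
| walk_eq_refl p : walk_eq a p p
| walk_eq_sym p q : walk_eq a p q -> walk_eq a q p
| walk_eq_trans q p r : walk_eq a p q -> walk_eq a q r -> walk_eq a p r
| walk_eq_triangle p b c q : [set last a p; b; c] \in D ->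
    walk_eq a (p ++ b :: c :: q) (p ++ c :: q)
| walk_eq_stutter p q : walk_eq a (p ++ last a p :: q) (p ++ q).

Lemma edge_vertex u v : edge D u v -> v \in vertices D.
Proof.
move=> uv; rewrite inE; apply: hD uv _.
by apply/subsetP => x; rewrite !inE => ->; rewrite orbT.
Qed.

Lemma edge_sym : symmetric (edge D).
Proof. by move=> u v; rewrite /edge /= setUC. Qed.

Lemma edge_refl v : v \in vertices D -> edge D v v.
Proof. by rewrite inE /edge /= setUid. Qed.

Lemma walk_last_vertex a p :
  a \in vertices D -> path (edge D) a p -> last a p \in vertices D.
Proof.
elim: p a => //= b p IH a av /andP[ab]; apply: IH; exact: edge_vertex ab.
Qed.

(** [walk_eq] does not require its sides to be walks. The edges changed by a move are faces of one
    simplex, or a repeated vertex already reached, so both sides are walks or neither is. *)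
Lemma walk_eq_path a p q : a \in vertices D -> walk_eq a p q ->
  path (edge D) a p = path (edge D) a q /\ last a p = last a q.
Proof.
move=> av; elim=> {p q} //.
- by move=> p q _ [-> ->].
- by move=> q p r _ [-> ->] _ [-> ->].
- move=> p b c q abc; rewrite !last_cat /=; split=> //.
  rewrite !cat_path /=.
  have [-> ->] : edge D (last a p) b /\ edge D b c.
    by split; apply: hD abc _; apply/subsetP => x; rewrite !inE => /orP[] ->;
      rewrite ?orbT.
  have -> // : edge D (last a p) c.
  by apply: hD abc _; apply/subsetP => x; rewrite !inE => /orP[] ->;
    rewrite ?orbT.
- move=> p q; rewrite !last_cat /=; split=> //.
  rewrite !cat_path /=; case: (boolP (path _ a p)) => //= ap.
  by rewrite edge_refl // walk_last_vertex.
Qed.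

Lemma walk_eq_closed a p q : a \in vertices D -> walk_eq a p q ->
  closed_walk a p = closed_walk a q.
Proof. by move=> av /(walk_eq_path av)[]; rewrite /closed_walk => -> ->. Qed.

Lemma walk_eq_cat a p q q' p' : walk_eq (last a p) q q' ->
  walk_eq a (p ++ q ++ p') (p ++ q' ++ p').
Proof.
elim=> {q q'}.
- by move=> q; exact: walk_eq_refl.
- by move=> q q' _; exact: walk_eq_sym.
- by move=> q q' q2 _ + _; exact: walk_eq_trans.
- move=> q b c q' abc; rewrite -!catA !cat_cons !(catA p).
  by apply: walk_eq_triangle; rewrite last_cat.
- move=> q q'; rewrite -!catA !cat_cons !(catA p) -last_cat.
  exact: walk_eq_stutter.
Qed.

Lemma walk_eq_prefix a p q q' : walk_eq (last a p) q q' ->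
  walk_eq a (p ++ q) (p ++ q').
Proof. by move=> /(walk_eq_cat [::]); rewrite !cats0. Qed.

Lemma walk_eq_suffix a q q' p' : walk_eq a q q' ->
  walk_eq a (q ++ p') (q' ++ p').
Proof. exact: (@walk_eq_cat a [::]). Qed.

(** A walk is listed without its starting vertex; the reverse starts at [last a p], which is
    therefore dropped, and ends with [a]. *)
Definition rev_walk (a : V) (p : seq V) := rev (belast a p).

Lemma rev_walk_cons a b p : rev_walk a (b :: p) = rcons (rev_walk b p) a.
Proof. by rewrite /rev_walk /= rev_cons. Qed.

Lemma last_rev_walk a p : last (last a p) (rev_walk a p) = a.
Proof. by case: p => //= b p; rewrite rev_walk_cons last_rcons. Qed.

Lemma rev_walkK a p : rev_walk (last a p) (rev_walk a p) = p.
Proof.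
have : last a p :: rev_walk a p = rev (a :: p).
  by rewrite /rev_walk -rev_rcons -lastI.
rewrite lastI last_rev_walk => /(congr1 rev).
by rewrite revK rev_rcons => -[].
Qed.

Lemma rev_walk_cat a p q :
  rev_walk a (p ++ q) = rev_walk (last a p) q ++ rev_walk a p.
Proof.
elim: p a => [|b p IH] a /=; first by rewrite cats0.
by rewrite !rev_walk_cons IH rcons_cat.
Qed.

Lemma path_rev_walk (e : rel V) a p : symmetric e ->
  path e (last a p) (rev_walk a p) = path e a p.
Proof.
move=> se; rewrite /rev_walk rev_path.
by apply: eq_path => x y; rewrite /= se.
Qed.

(** The inner backtracking cancels by induction. What remains is [a, b, a], a degenerate triangle on
    the edge [a b], followed by a stutter. *)
Lemma walk_eq_backtrack a p : a \in vertices D -> path (edge D) a p ->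
  walk_eq a (p ++ rev_walk a p) [::].
Proof.
elim: p a => [|b p IH] a av; first by move=> _; exact: walk_eq_refl.
move=> /= /andP[ab bp]; rewrite rev_walk_cons -cats1 catA.
apply: (walk_eq_trans (q := [:: b; a])).
  apply: (@walk_eq_cat a [:: b] _ [::] [:: a]).
  by apply: IH => //; exact: edge_vertex ab.
apply: (walk_eq_trans (q := [:: a])).
  apply: (@walk_eq_triangle a [::] b a [::]).
  by apply: hD ab _; apply/subsetP => x; rewrite !inE -orbA orbCA orbb orbC.
exact: (walk_eq_stutter a [::] [::]).
Qed.

Lemma closed_walk_cat a p q : closed_walk a p -> closed_walk a q ->
  closed_walk a (p ++ q).
Proof.
by rewrite /closed_walk cat_path last_cat => /andP[-> /eqP ->].
Qed.

End Walks.

(** * Generators from a spanning tree *)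

Section ShortestPaths.
Variables (V : finType) (e : rel V) (r : V).

(** [depth] is the distance from [r] and [parent v] the penultimate vertex of a shortest path. The
    equation between depths serves both to build the tree paths and to exclude cycles. *)
Lemma shortest_path_tree : exists (depth : V -> nat) (parent : V -> V),
  depth r = 0 /\ forall v, connect e r v -> v != r ->
    [/\ connect e r (parent v), e (parent v) v & depth v = (depth (parent v)).+1].
Proof.
have [depth hdepth] : exists depth : V -> nat, forall v, connect e r v ->
    (exists p, [/\ path e r p, last r p = v & size p = depth v]) /\
    (forall p, path e r p -> last r p = v -> depth v <= size p).
  apply: (@fin_all_exists _ _ (fun v n => connect e r v ->
    (exists p, [/\ path e r p, last r p = v & size p = n]) /\
    (forall p, path e r p -> last r p = v -> n <= size p))) => v.
  case: (boolP (connect e r v)) => rv; last by exists 0.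
  pose P n := [exists t : n.-tuple V, path e r t && (last r t == v)].
  have exP : exists n, P n.
    case/connectP: rv => p ep lp; exists (size p).
    by apply/existsP; exists (in_tuple p); rewrite ep -lp eqxx.
  case: (ex_minnP exP) => n /existsP[t /andP[et /eqP lt]] minn.
  exists n => _; split; first by exists t; rewrite size_tuple.
  move=> p ep lp; apply: minn; apply/existsP; exists (in_tuple p).
  by rewrite ep lp eqxx.
have [parent hparent] : exists parent : V -> V, forall v, connect e r v ->
    v != r -> [/\ connect e r (parent v), e (parent v) v
      & depth v = (depth (parent v)).+1].
  apply: (@fin_all_exists _ _ (fun v u => connect e r v -> v != r ->
    [/\ connect e r u, e u v & depth v = (depth u).+1])) => v.
  case: (boolP (connect e r v)) => rv; last by exists v.
  case: eqVneq => [|vr]; first by exists v.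
  have [[p [ep lp sp]] min_v] := hdepth v rv.
  case/lastP: p => [|p w] in ep lp sp; first by rewrite -lp eqxx in vr.
  rewrite last_rcons in lp; rewrite lp {w lp} in ep sp.
  move: ep; rewrite rcons_path => /andP[ep pv].
  exists (last r p) => _ _; have rp : connect e r (last r p) by apply/connectP; exists p.
  split=> //; have [[q [eq lq sq]] min_p] := hdepth _ rp.
  apply/eqP; rewrite eqn_leq; apply/andP; split.
    rewrite -sq -(size_rcons q v); apply: min_v; rewrite ?last_rcons //.
    by rewrite rcons_path eq lq.
  by rewrite -sp size_rcons ltnS; exact: min_p.
exists depth, parent; split=> //.
have [_ /(_ [::] isT erefl)] := hdepth r (connect0 _ _).
by rewrite leqn0 => /eqP.
Qed.

End ShortestPaths.

Section Generators.
Variables (V : finType) (D : {set {set V}}) (r : V) (K : {set V * V}).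
Hypothesis hD : simplicial_complex D.
Hypothesis rD : r \in vertices D.
Hypothesis connD : forall v, v \in vertices D -> connect (edge D) r v.
Hypothesis K_edge : forall a b, (a, b) \in K -> edge D a b.

Definition kedge : rel V := [rel a b | ((a, b) \in K) || ((b, a) \in K)].

Hypothesis edge_walk : forall a b, edge D a b ->
  exists q, [/\ path kedge a q, last a q = b & walk_eq D a [:: b] q].

Lemma kedge_sym : symmetric kedge.
Proof. by move=> a b; rewrite /kedge /= orbC. Qed.

Lemma kedge_edge : subrel kedge (edge D).
Proof.
by move=> a b /orP[] /K_edge //; rewrite edge_sym.
Qed.

Lemma walk_kept a p : path (edge D) a p ->
  exists q, [/\ path kedge a q, last a q = last a p & walk_eq D a p q].
Proof.
elim: p a => [|b p IH] a; first by exists [::]; split=> //; exact: walk_eq_refl.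
move=> /= /andP[/edge_walk[q1 [kq1 lq1 e1]] /IH[q2 [kq2 lq2 e2]]].
exists (q1 ++ q2); split; first by rewrite cat_path kq1 lq1.
  by rewrite last_cat lq1.
apply: (walk_eq_trans (q := q1 ++ p)).
  exact: (walk_eq_suffix p e1).
by apply: walk_eq_prefix; rewrite lq1.
Qed.

(** The generators are the loops of the pairs of [K] outside a spanning tree, each closed up by tree
    paths. Loops of tree edges contract by backtracking, and a walk in [K] telescopes into edge
    loops. *)
Lemma kept_generators : exists (k : nat) (gen : 'I_k -> seq V),
  [/\ k + #|vertices D| = #|K|.+1,
   forall i, closed_walk D r (gen i) &
   forall G : seq V -> Prop, G [::] ->
    (forall p q, closed_walk D r p -> closed_walk D r q ->
      G p -> G q -> G (p ++ q)) ->
    (forall p, closed_walk D r p -> G p -> G (rev_walk r p)) ->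
    (forall p q, closed_walk D r p -> walk_eq D r p q -> G p -> G q) ->
    (forall i, G (gen i)) ->
    forall p, closed_walk D r p -> G p].
Proof.
have connK v : v \in vertices D -> connect kedge r v.
  move/connD/connectP => [p pp ->]; have [q [kq <- _]] := walk_kept pp.
  by apply/connectP; exists q.
have kvertex a b : kedge a b -> (a \in vertices D) * (b \in vertices D).
  move=> /kedge_edge ab; split; last exact: edge_vertex ab.
  by rewrite edge_sym in ab; exact: edge_vertex ab.
have Kvertex v : connect kedge r v -> v \in vertices D.
  case/connectP=> p; case/lastP: p => [_ -> //|p w].
  by rewrite rcons_path last_rcons => /andP[_ /kvertex[_ ?]] ->.
have [depth [parent [depth0 tree]]] := shortest_path_tree kedge r.
(* The tree path from [r] to [v]: iterating [parent] exactly [depth v] times stops just before [r],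
   which a walk omits. *)
pose tau v := rev (traject parent v (depth v)).
have tau_r : tau r = [::] by rewrite /tau depth0.
have tauS v : connect kedge r v -> v != r -> tau v = rcons (tau (parent v)) v.
  by move=> rv vr; have [_ _ dv] := tree v rv vr; rewrite /tau dv trajectS rev_cons.
have tauP v : connect kedge r v -> path kedge r (tau v) /\ last r (tau v) = v.
  have [n le_n] := ubnP (depth v); elim: n v le_n => // n IH v le_n rv.
  have [->|vr] := eqVneq v r; first by rewrite tau_r.
  have [rp pv dv] := tree v rv vr.
  have [|kp lp] := IH (parent v) _ rp; first by rewrite dv in le_n.
  by rewrite tauS // last_rcons rcons_path kp lp pv.
pose edge_loop a b := tau a ++ b :: rev_walk r (tau b).
have wtau v : v \in vertices D -> path (edge D) r (tau v) /\ last r (tau v) = v.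
  by move/connK/tauP => [kv lv]; split=> //; apply: sub_path kv; exact: kedge_edge.
have wrho v : v \in vertices D -> path (edge D) v (rev_walk r (tau v)) /\
    last v (rev_walk r (tau v)) = r.
  move=> /wtau[wv lv]; split.
    by rewrite -{1}lv path_rev_walk //; exact: edge_sym.
  by rewrite -{1}lv last_rev_walk.
have loop_closed a b : edge D a b -> closed_walk D r (edge_loop a b).
  move=> ab; have bv := edge_vertex hD ab.
  have av : a \in vertices D by rewrite edge_sym in ab; exact: edge_vertex ab.
  have [wa la] := wtau a av; have [wb lb] := wrho b bv.
  by rewrite /closed_walk cat_path last_cat /= wa la ab wb lb eqxx.
have loop_rev a b : kedge a b -> rev_walk r (edge_loop a b) = edge_loop b a.
  move=> ab; have [av bv] := kvertex a b ab.
  have [wa la] := wtau a av; have [wb lb] := wtau b bv.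
  rewrite /edge_loop rev_walk_cat rev_walk_cons la -{1}lb rev_walkK.
  by rewrite -cats1 -catA.
(* [K] consists of ordered pairs, so the tree edge at [v] is taken in an orientation that occurs in
   [K]. *)
pose tpair v := if (parent v, v) \in K then (parent v, v) else (v, parent v).
pose T := [set tpair v | v in vertices D :\ r].
have treeD v : v \in vertices D :\ r ->
    [/\ parent v \in vertices D, kedge (parent v) v & depth v = (depth (parent v)).+1].
  rewrite in_setD1 => /andP[vr vD].
  have [rp pv dv] := tree v (connK v vD) vr; split=> //; exact: Kvertex.
have TK : T \subset K.
  apply/subsetP => _ /imsetP[v /treeD[_ pv _] ->]; rewrite /tpair.
  by case: ifP => // h; move: pv; rewrite /kedge /= h.
have cardT : #|T|.+1 = #|vertices D|.
  rewrite card_in_imset; first by rewrite [RHS](cardsD1 r) rD.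
  (* Distinct vertices with the same pair would be parents of each other, which the depths
     forbid. *)
  move=> u v /treeD[_ _ du] /treeD[_ _ dv]; rewrite /tpair.
  case: ifP => _; case: ifP => _ [] // h1 h2; exfalso.
    by move: du dv; rewrite h1 -h2; lia.
  by move: du dv; rewrite -h1 h2; lia.
pose N := K :\: T.
exists #|N|, (fun i => edge_loop (enum_val i).1 (enum_val i).2); split.
- have := cardsD K T; rewrite (setIidPr TK) -/N => ->.
  by rewrite -cardT addnS subnK ?subset_leq_card.
- move=> i; apply: loop_closed; apply: K_edge; rewrite -surjective_pairing.
  by have := enum_valP i; rewrite inE => /andP[].
move=> G G1 GM GV GE Ggen.
have Gtriv p : path (edge D) r p -> G (p ++ rev_walk r p).
  move=> wp; apply: (GE [::]) => //; first by rewrite /closed_walk /= eqxx.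
  by apply: walk_eq_sym; exact: walk_eq_backtrack.
have Gsym a b : kedge a b -> G (edge_loop a b) -> G (edge_loop b a).
  move=> ab Gab; rewrite -loop_rev //; apply: GV => //.
  by apply: loop_closed; exact: kedge_edge.
have Gtree v : v \in vertices D :\ r -> G (edge_loop (parent v) v).
  move=> vD; have [pD pv _] := treeD v vD.
  have vD' : v \in vertices D by move: vD; rewrite in_setD1 => /andP[].
  have vr : v != r by move: vD; rewrite in_setD1 => /andP[].
  rewrite /edge_loop -cat_rcons -tauS ?connK //.
  by apply: Gtriv; case: (wtau v vD').
have GK a b : (a, b) \in K -> G (edge_loop a b).
  move=> abK; case: (boolP ((a, b) \in T)) => abT; last first.
    have abN : (a, b) \in N by rewrite inE abT.
    by have := Ggen (enum_rank_in abN (a, b)); rewrite enum_rankK_in.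
  case/imsetP: abT => v vD; have [_ pv _] := treeD v vD.
  rewrite /tpair; case: ifP => _ [-> ->]; first exact: Gtree.
  by apply: Gsym pv _; exact: Gtree.
have Gk a b : kedge a b -> G (edge_loop a b).
  move=> /[dup] ab /orP[]; first exact: GK.
  by move=> /GK; apply: Gsym; rewrite kedge_sym.
(* Closing up by tree paths frees both endpoints, which makes induction on the walk possible; for a
   closed walk at [r] these tree paths are empty. *)
have Gwalk a q : a \in vertices D -> path kedge a q ->
    G (tau a ++ q ++ rev_walk r (tau (last a q))).
  elim: q a => [|b q IH] a av; first by move=> _; apply: Gtriv; case: (wtau a av).
  move=> /= /andP[ab kq]; have [_ bv] := kvertex a b ab.
  have [wa la] := wtau a av; have [wb lb] := wtau b bv.
  have [wb' lb'] := wrho b bv.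
  have wq : path (edge D) b q by apply: sub_path kq; exact: kedge_edge.
  have lqv : last b q \in vertices D by exact: walk_last_vertex.
  have [wl ll] := wrho _ lqv.
  have c1 := loop_closed a b (kedge_edge ab).
  have c2 : closed_walk D r (tau b ++ q ++ rev_walk r (tau (last b q))).
    by rewrite /closed_walk !cat_path !last_cat wb lb wq wl ll eqxx.
  apply: (GE _ _ (closed_walk_cat c1 c2)); last by apply: GM => //; [exact: Gk|exact: IH].
  rewrite /edge_loop -catA; apply: walk_eq_prefix; rewrite la.
  (* Between two consecutive edge loops the way back to [r] cancels against the way out again. *)
  have cancel : walk_eq D b (rev_walk r (tau b) ++ tau b) [::].
    have revrho : rev_walk b (rev_walk r (tau b)) = tau b by rewrite -{1}lb rev_walkK.
    by have := walk_eq_backtrack hD bv wb'; rewrite revrho.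
  have := walk_eq_suffix (q ++ rev_walk r (tau (last b q))) cancel.
  rewrite -catA => cancel'.
  exact: (@walk_eq_prefix _ D a [:: b] _ _ cancel').
move=> p wp; case/andP: (wp) => pp /eqP lp.
have [q [kq lq eq]] := walk_kept pp.
apply: (GE q p); last first.
- by have := Gwalk r q rD kq; rewrite lq lp tau_r cats0.
- exact: walk_eq_sym.
- by rewrite -(walk_eq_closed hD rD eq).
Qed.

End Generators.

(** * Lower links *)

Section Components.
Variables (V : finType) (D : {set {set V}}).
Hypothesis hD : simplicial_complex D.

Lemma simplicial_induced W : simplicial_complex (induced D W).
Proof.
move=> A B; rewrite !inE => /andP[AD AW] BA.
by rewrite (hD AD BA) (subset_trans BA AW).
Qed.

Lemma simplicial_link A : simplicial_complex (link A D).
Proof.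
move=> B C; rewrite !inE => /and3P[BD ABD AB0] CB; apply/and3P; split.
- exact: hD BD CB.
- by apply: hD ABD _; exact: setUS.
- by rewrite -subset0 -(eqP AB0) setIS.
Qed.

Lemma connect_edge_sym : connect_sym (edge D).
Proof. exact/sym_connect_sym/edge_sym. Qed.

Lemma connect_vertex r v : r \in vertices D -> connect (edge D) r v ->
  v \in vertices D.
Proof. by move=> rD /connectP[p wp ->]; exact: walk_last_vertex. Qed.

Section OneComponent.
Variable r : V.
Hypothesis rD : r \in vertices D.
Local Notation C := (component D r).

Lemma vertices_component v : (v \in vertices C) = connect (edge D) r v.
Proof.
rewrite !inE sub1set inE; case: (boolP (connect _ r v)); rewrite ?andbF // andbT.
by move/(connect_vertex rD); rewrite inE.
Qed.

Lemma edge_component a b : connect (edge D) r a -> edge D a b -> edge C a b.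
Proof.
move=> ra ab; rewrite /edge /= inE -[_ \in D]/(edge D a b) ab.
apply/subsetP => x; rewrite !inE => /orP[]/eqP -> //.
exact: connect_trans ra (connect1 ab).
Qed.

Lemma path_component a p : connect (edge D) r a -> path (edge D) a p ->
  path (edge C) a p.
Proof.
elim: p a => //= b p IH a ra /andP[ab bp]; rewrite edge_component //.
by apply: IH => //; exact: connect_trans ra (connect1 ab).
Qed.

Lemma connect_component v : v \in vertices C -> connect (edge C) r v.
Proof.
rewrite vertices_component => /connectP[p wp ->]; apply/connectP.
by exists p => //; exact: path_component.
Qed.

(** A walk from a vertex of the component stays in it, and so do the triangles of its moves; being a
    walk is passed along the chain of moves by [walk_eq_path]. *)
Lemma walk_eq_component a p q : connect (edge D) r a -> walk_eq D a p q ->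
  path (edge D) a p -> walk_eq C a p q.
Proof.
move=> ra; have aD : a \in vertices D by exact: connect_vertex ra.
elim=> {p q}.
- by move=> p _; exact: walk_eq_refl.
- move=> p q pq IH wq; apply/walk_eq_sym/IH.
  by have [-> _] := walk_eq_path hD aD pq.
- move=> q p p' pq IH qp IH' wp; apply: walk_eq_trans (IH wp) (IH' _).
  by have [<- _] := walk_eq_path hD aD pq.
- move=> p b c q abc; rewrite cat_path /= => /and4P[wp ab bc _].
  apply: walk_eq_triangle; rewrite inE abc.
  have rl : connect (edge D) r (last a p).
    by apply: connect_trans ra _; apply/connectP; exists p.
  have rb := connect_trans rl (connect1 ab).
  have rc := connect_trans rb (connect1 bc).
  by apply/subsetP => x; rewrite !inE => /orP[/orP[]|] /eqP ->.
- by move=> p q _; exact: walk_eq_stutter.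
Qed.

End OneComponent.
End Components.

Section KeptPairs.
Variables (V : finType) (D : {set {set V}}) (s : seq V).
Hypothesis hD : simplicial_complex D.
Hypothesis mem_s : forall v, v \in s.

(** The successor keeps [a] itself in the induced complex, as in [mu_order]; without it the link
    would be void. *)
Definition lower_link (a : V) :=
  link [set a] (induced D [set u in take (index a s).+1 s]).

(* [roots] selects one vertex in each component of the lower link. *)
Definition kept_pairs : {set V * V} :=
  [set x | (x.2 \in roots (edge (lower_link x.1)))
             && (x.2 \in vertices (lower_link x.1))].

Lemma simplicial_lower_link a : simplicial_complex (lower_link a).
Proof. exact/simplicial_link/simplicial_induced. Qed.

Lemma index_seq_inj : injective (index^~ s).
Proof.
by move=> u v uv; rewrite -(nth_index u (mem_s u)) [index u s]uv nth_index.
Qed.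

Lemma lower_link_vertex a b :
  (b \in vertices (lower_link a)) = edge D a b && (index b s < index a s).
Proof.
apply/idP/idP.
  rewrite inE !inE => /and3P[/andP[_ +] /andP[ab _] ab0].
  rewrite sub1set inE in_take // ltnS => ba.
  rewrite /edge /= ab /= ltn_neqAle ba andbT.
  apply: contraTneq ab0 => /index_seq_inj ->.
  by rewrite setIid -subset0 sub1set inE.
case/andP=> ab ba.
have bD : b \in vertices D by exact: edge_vertex ab.
rewrite inE !inE; apply/and3P; split.
- rewrite sub1set inE in_take // ltnS ltnW // andbT.
  by rewrite inE in bD.
- rewrite -[_ \in D]/(edge D a b) ab; apply/subsetP => x.
  by rewrite !inE => /orP[]/eqP ->; rewrite in_take // ltnS // ltnW.
- rewrite -subset0; apply/subsetP => x; rewrite !inE => /andP[/eqP-> /eqP ab'].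
  by rewrite ab' ltnn in ba.
Qed.

Lemma lower_link_edge a b c : edge (lower_link a) b c -> [set a; b; c] \in D.
Proof.
by rewrite /edge /= !inE => /and3P[_ /andP[+ _] _]; rewrite setUA.
Qed.

Lemma kept_pairs_edge a b :
  (a, b) \in kept_pairs -> edge D a b && (index b s < index a s).
Proof. by rewrite inE /= lower_link_vertex => /andP[]. Qed.

Lemma card_kept_pairs : #|kept_pairs| = \sum_a b0 (lower_link a).
Proof.
transitivity (\sum_(a : V) \sum_(b : V | (a, b) \in kept_pairs) 1).
  by rewrite -sum1_card pair_big_dep /=; apply: eq_bigl => -[a b].
apply: eq_bigr => a _; rewrite /b0 /n_comp_mem -sum1_card.
by apply: eq_bigl => b; rewrite !inE.
Qed.

Lemma kept_edge_walk a b : edge D a b ->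
  exists q, [/\ path (kedge kept_pairs) a q, last a q = b
    & walk_eq D a [:: b] q].
Proof.
pose Q a b := exists q, [/\ path (kedge kept_pairs) a q, last a q = b
    & walk_eq D a [:: b] q].
rewrite -/(Q a b).
have Q_kept u v : kedge kept_pairs u v -> Q u v.
  by move=> uv; exists [:: v]; rewrite /= uv; split=> //; exact: walk_eq_refl.
have Q_trans u w v : [set u; w; v] \in D -> Q u w -> Q w v -> Q u v.
  move=> uwv [q1 [k1 l1 e1]] [q2 [k2 l2 e2]]; exists (q1 ++ q2); split.
  - by rewrite cat_path k1 l1.
  - by rewrite last_cat l1.
  apply: (walk_eq_trans (q := [:: w; v])).
    by apply: walk_eq_sym; exact: (@walk_eq_triangle _ D u [::] w v [::]).
  apply: (walk_eq_trans (q := q1 ++ [:: v])).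
    exact: (walk_eq_suffix [:: v] e1).
  by apply: walk_eq_prefix; rewrite l1.
(* Induction on a bound for the position of the later endpoint. Both orientations are carried along,
   since the sliding step uses the edge of the link in either direction. *)
suff Qn n : forall u v, index v s <= index u s < n -> edge D u v -> Q u v /\ Q v u.
  move=> ab; case: (leqP (index b s) (index a s)) => ba.
    by case: (Qn (index a s).+1 a b) => //; rewrite ba /=.
  case: (Qn (index b s).+1 b a) => //; first by rewrite ltnW /=.
  by rewrite edge_sym.
elim: n => [|n IH] u v; first by rewrite ltn0 andbF.
case/andP=> vu un uv.
have {}IH x y : index x s < n -> index y s < n -> edge D x y -> Q x y /\ Q y x.
  move=> xn yn xy; case: (leqP (index y s) (index x s)) => yx.
    by apply: IH; rewrite ?yx.
  by case: (IH y x) => //; [rewrite ltnW|rewrite edge_sym].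
(* [edge D] also holds between a vertex and itself; this degenerate edge is a stutter. *)
move: vu; rewrite leq_eqVlt => /orP[/eqP/index_seq_inj ->|vu].
  have Quu : Q u u.
    by exists [::]; split=> //; exact: (walk_eq_stutter D u [::] [::]).
  by split.
have vL : v \in vertices (lower_link u) by rewrite lower_link_vertex uv.
have symL := connect_edge_sym (lower_link u).
have /connectP[p wp lp] := connect_root (edge (lower_link u)) v.
(* Inner induction along a path of the lower link from [v] to the representative of its component;
   when the path is empty, the edge [u v] is itself kept. *)
elim: p v {uv vu} vL wp lp => [|w p IHp] v vL.
  move=> _ /= rv.
  have uvK : kedge kept_pairs u v.
    by apply/orP; left; rewrite inE vL andbT; apply/eqP.
  by split; apply: Q_kept => //; rewrite kedge_sym.
move=> /= /andP[vw wp] lp.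
have wL : w \in vertices (lower_link u).
  by apply: edge_vertex vw; exact: simplicial_lower_link.
have [|Quw Qwu] := IHp w wL wp.
  by rewrite -lp; apply/eqP; rewrite (root_connect symL) symL connect1.
have uvw := lower_link_edge vw.
have vwD : edge D v w.
  by apply: hD uvw _; apply/subsetP => x; rewrite !inE => /orP[] ->; rewrite ?orbT.
move: vL wL; rewrite !lower_link_vertex => /andP[_ vu] /andP[_ wu].
(* Both [v] and [w] precede [u], so the outer induction covers the edge between them. *)
have [||Qvw Qwv] := IH v w _ _ vwD.
- exact: leq_trans vu un.
- exact: leq_trans wu un.
split.
  by apply: (Q_trans u w v) => //; rewrite setUAC.
apply: (Q_trans v w u) => //.
rewrite (_ : [set v; w; u] = [set u; v; w]) //.
by apply/setP => x; rewrite !inE orbC orbA.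
Qed.

(** The kept pairs of the whole complex are restricted to the component, not chosen anew inside it,
    so that the counts can be added over the components. *)
Lemma component_generators r : r \in vertices D ->
  exists (k : nat) (gen : 'I_k -> seq V),
  [/\ k + #|[set v | connect (edge D) r v]| =
        #|[set x in kept_pairs | connect (edge D) r x.1]|.+1,
   forall i, closed_walk (component D r) r (gen i) &
   forall G : seq V -> Prop, G [::] ->
    (forall p q, closed_walk (component D r) r p ->
      closed_walk (component D r) r q -> G p -> G q -> G (p ++ q)) ->
    (forall p, closed_walk (component D r) r p -> G p -> G (rev_walk r p)) ->
    (forall p q, closed_walk (component D r) r p ->
      walk_eq (component D r) r p q -> G p -> G q) ->
    (forall i, G (gen i)) ->
    forall p, closed_walk (component D r) r p -> G p].
Proof.
move=> rD; have -> : [set v | connect (edge D) r v] = vertices (component D r).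
  by apply/setP => v; rewrite in_set (vertices_component hD rD).
set K := [set x in _ | _].
apply: kept_generators.
- exact: simplicial_induced.
- by rewrite vertices_component.
- by move=> v; exact: connect_component.
- move=> a b; rewrite inE => /andP[/kept_pairs_edge/andP[ab _] ra].
  exact: edge_component.
- move=> a b abC.
  have ra : connect (edge D) r a.
    have aC : a \in vertices (component D r).
      by rewrite edge_sym in abC; apply: edge_vertex abC; exact: simplicial_induced.
    by rewrite vertices_component in aC.
  have ab : edge D a b by move: abC; rewrite /edge /= inE => /andP[].
  have [q [kq lq eq]] := kept_edge_walk ab.
  exists q; split=> //; last by apply: walk_eq_component => //=; rewrite ab.
  (* The kept walk never leaves the component, so its pairs survive the restriction. *)
  elim: q a ra kq {eq lq ab abC} => //= c q IH a ra /andP[ac cq].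
  have acD : edge D a c.
    by case/orP: ac => /kept_pairs_edge/andP[] //; rewrite edge_sym.
  have rc := connect_trans ra (connect1 acD).
  rewrite IH // andbT; case/orP: ac => h; apply/orP; [left|right];
    by rewrite in_set h.
Qed.

(** Vertices are grouped by the root of their component and pairs by that of their first entry; each
    root contributes the summand 1 that makes up [b0 D]. *)
Lemma sum_component_generators (k : V -> nat) :
  (forall r, r \in vertices D -> k r + #|[set v | connect (edge D) r v]| =
     #|[set x in kept_pairs | connect (edge D) r x.1]|.+1) ->
  \sum_(r in [predI roots (edge D) & vertices D]) k r + #|vertices D| =
  #|kept_pairs| + b0 D.
Proof.
move=> hk; have symD := connect_edge_sym D.
have root_r r v : r \in roots (edge D) ->
    connect (edge D) r v = (fingraph.root (edge D) v == r).
  by move=> /eqP rr; rewrite symD -(root_connect symD) rr.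
have -> : #|vertices D| = \sum_(r in [predI roots (edge D) & vertices D])
    #|[set v | connect (edge D) r v]|.
  rewrite -sum1_card (partition_big (fingraph.root (edge D))
    (mem [predI roots (edge D) & vertices D])) /=.
    apply: eq_bigr => r /andP[rr rD]; rewrite -sum1_card; apply: eq_bigl => v.
    rewrite inE root_r //; case: eqP => [rv|]; rewrite ?andbF // andbT.
    by apply: (connect_vertex hD rD); rewrite root_r // rv.
  move=> v vD; apply/andP; split; first exact: roots_root.
  by apply: (connect_vertex hD vD); exact: connect_root.
have -> : #|kept_pairs| = \sum_(r in [predI roots (edge D) & vertices D])
    #|[set x in kept_pairs | connect (edge D) r x.1]|.
  rewrite -sum1_card (partition_big (fun x => fingraph.root (edge D) x.1)
    (mem [predI roots (edge D) & vertices D])) /=.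
    apply: eq_bigr => r /andP[rr rD]; rewrite -sum1_card; apply: eq_bigl => x.
    by rewrite [in RHS]inE root_r.
  move=> [a b] /kept_pairs_edge/andP[ab _]; apply/andP; split; first exact: roots_root.
  rewrite edge_sym in ab.
  by apply: (connect_vertex hD (edge_vertex hD ab)); exact: connect_root.
rewrite -big_split /= /b0 /n_comp_mem -sum1_card -big_split /=.
by apply: eq_bigr => r /andP[_ rD]; rewrite hk // addn1.
Qed.

End KeptPairs.

(** * Betti numbers *)

Section BettiBounds.
Local Open Scope ring_scope.
Variables (F : fieldType) (V : finType) (D : {set {set V}}).
Hypothesis hD : simplicial_complex D.

Lemma mem_faces (i : int) A : (A \in faces D i) = (A \in D) && (#|A|%:Z == i + 1).
Proof. by rewrite inE. Qed.

(** An equation on the index, in place of a literal, fits indices such as [-1 + 1], on which the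
    types of the matrices depend. *)
Lemma faces_vertex (i : int) v : i = 0 -> v \in vertices D -> [set v] \in faces D i.
Proof. by move=> ->; rewrite mem_faces !inE cards1 => ->. Qed.

Lemma card_faces_empty (i : int) : i = -1 -> (#|faces D i| <= (set0 \in D))%N.
Proof.
move=> ->; case: (boolP (set0 \in D)) => h0.
  apply: (@leq_trans #|[set (@set0 V)]|); last by rewrite cards1.
  apply/subset_leq_card/subsetP => A.
  by rewrite mem_faces => /andP[_ /eqP]; rewrite addNr => -[] /cards0_eq ->; rewrite inE.
rewrite leqn0 cards_eq0; apply/eqP/setP => A; rewrite mem_faces inE.
apply/negP => /andP[AD /eqP]; rewrite addNr => -[] /cards0_eq A0.
by rewrite A0 (negPf h0) in AD.
Qed.

Lemma incidence_set1 v : @incidence F V [set v] set0 = 1.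
Proof.
rewrite /incidence (bigD1 v) /=; last by rewrite set11 setDv eqxx.
rewrite big1 ?addr0; last by move=> u; rewrite !inE => /andP[/andP[->]].
rewrite (_ : [set u in _ | _] = set0) ?cards0 //; apply/setP => u; rewrite !inE.
by case: eqP => // ->; rewrite ltnn.
Qed.

(** The ends of an edge enter its boundary with opposite signs, so a function with equal values at
    both ends vanishes on the boundary. *)
Lemma incidence_set2 (u w : V) : u != w ->
  \sum_(v in [set u; w]) (-1 : F) ^+
    #|[set x in [set u; w] | (enum_rank x < enum_rank v)%N]| = 0.
Proof.
wlog uw : u w / (enum_rank u < enum_rank w)%N.
  move=> H uw; case: (ltngtP (enum_rank u) (enum_rank w)) => h; first exact: H.
    by rewrite [[set u; w]]setUC; apply: H; rewrite // eq_sym.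
  by case/eqP: uw; apply: enum_rank_inj; exact: val_inj.
move=> nuw; rewrite big_setU1 ?inE // big_set1 /=.
rewrite (_ : [set x in _ | (_ < enum_rank u)%N] = set0); last first.
  apply/setP => x; rewrite !inE; case: eqP => [->|_] /=; first by rewrite ltnn.
  by case: eqP => [->|_] //=; rewrite ltnNge ltnW.
rewrite (_ : [set x in _ | (_ < enum_rank w)%N] = [set u]); last first.
  apply/setP => x; rewrite !inE; case: eqP => [->|_] /=; first by rewrite uw.
  by case: eqP => [->|_] //=; rewrite ltnn.
by rewrite cards0 cards1 expr0 expr1 subrr.
Qed.

(** Here [g] is a family of cochains given on sets; the product evaluates them on the boundary of a
    face, and closure under inclusion puts every facet among the row indices. *)
Lemma boundary_mul (m : nat) (g : {set V} -> 'I_m -> F) (i : int)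
    (a : 'I_#|faces D i|) (j : 'I_m) :
  (boundary F D i *m \matrix_(b, j) g (enum_val b) j) a j =
  \sum_(v in enum_val a) (-1) ^+
    #|[set u in enum_val a | (enum_rank u < enum_rank v)%N]| *
    g (enum_val a :\ v) j.
Proof.
set A := enum_val a.
have := enum_valP a; rewrite -/A mem_faces => /andP[AD /eqP cA].
rewrite mxE.
transitivity (\sum_(B in faces D (i - 1)) @incidence F V A B * g B j).
  rewrite [RHS]big_enum_val; apply: eq_bigr => b _; by rewrite !mxE.
rewrite /incidence; under eq_bigr do rewrite mulr_suml.
rewrite (exchange_big_dep (mem A)) /=; last by move=> B v _ /andP[].
apply: eq_bigr => v vA; rewrite (big_pred1 (A :\ v)) // => B /=.
rewrite vA /=; case: eqP => [->|_]; rewrite ?andbF // andbT mem_faces.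
rewrite (hD AD) ?subD1set //= subrK.
by move: cA; rewrite (cardsD1 v A) vA add1n -addn1 PoszD => /(canRL (addrK _)) ->;
  rewrite addrK eqxx.
Qed.

(** The indicator functions of the components are linearly independent and vanish on boundaries of
    edges, so their number adds to the rank of the boundary. *)
Lemma rank_boundary_edges (i : int) : i = 1 ->
  (\rank (boundary F D i) + b0 D <= #|faces D (i - 1)|)%N.
Proof.
move=> i1; set c := b0 D.
pose C := [set v | (v \in roots (edge D)) && (v \in vertices D)].
have cC : c = #|C|.
  by rewrite /c /b0 /n_comp_mem; apply: eq_card => v; rewrite !inE.
rewrite cC.
(* The sum has one term on a singleton and none elsewhere, which extends a function on vertices to
   all sets. *)
pose g (B : {set V}) (j : 'I_#|C|) : F :=
  \sum_(v | B == [set v]) (fingraph.root (edge D) v == enum_val j)%:R.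
have g1 v j : g [set v] j = (fingraph.root (edge D) v == enum_val j)%:R.
  by rewrite /g (big_pred1 v) // => u /=; rewrite (inj_eq set1_inj) eq_sym.
pose M := \matrix_(b < #|faces D (i - 1)|, j < #|C|) g (enum_val b) j.
have BM0 : boundary F D i *m M = 0.
  apply/matrixP => a j; rewrite boundary_mul mxE.
  have := enum_valP a; rewrite mem_faces (_ : i + 1 = 2); last by rewrite i1.
  case/andP=> AD /cards2P[u [w [uw Auw]]].
  rewrite Auw in AD *.
  have guw : g [set u] j = g [set w] j.
    rewrite !g1; congr (_ == _)%:R; apply/eqP.
    by rewrite (root_connect (connect_edge_sym D)) connect1.
  transitivity (\sum_(v in [set u; w]) (-1) ^+
     #|[set x in [set u; w] | (enum_rank x < enum_rank v)%N]| * g [set u] j).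
    apply: eq_bigr => v; rewrite !inE => /orP[]/eqP ->; congr (_ * _).
      rewrite (_ : _ :\ u = [set w]) ?guw //; apply/setP => x; rewrite !inE.
      by case: eqP => [->|] //=; rewrite (negPf uw).
    rewrite (_ : _ :\ w = [set u]) //; apply/setP => x; rewrite !inE.
    by case: (eqVneq x w) => [->|] //=; rewrite ?orbF // eq_sym (negPf uw).
  by rewrite -mulr_suml incidence_set2 // mul0r.
(* [N] selects the rows of the representatives, a left inverse of [M], so [M] has full column
   rank. *)
pose N : 'M[F]_(#|C|, #|faces D (i - 1)|) := \matrix_(j < #|C|, b < #|faces D (i - 1)|)
  (enum_val b == [set enum_val j])%:R.
have NM : N *m M = 1%:M.
  apply/matrixP => j k; rewrite !mxE.
  have := enum_valP j; rewrite inE => /andP[rj jD].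
  have jf : [set enum_val j] \in faces D (i - 1) by apply: faces_vertex; rewrite ?i1.
  transitivity (\sum_(B in faces D (i - 1)) (B == [set enum_val j])%:R * g B k).
    by rewrite [RHS]big_enum_val; apply: eq_bigr => b _; rewrite !mxE.
  rewrite (bigD1 _ jf) /= eqxx mul1r big1 ?addr0; last first.
    by move=> B /andP[_ /negPf ->]; rewrite mul0r.
  by rewrite g1 (eqP rj) (inj_eq enum_val_inj).
have rM : (#|C| <= \rank M)%N.
  by rewrite -{1}(mxrank1 F #|C|) -NM mxrankM_maxr.
apply: leq_trans (mulmx0_rank_max BM0).
by rewrite leq_add2l.
Qed.

(** The Boolean term tells the void complex, where all terms are 0, from the complex with the empty
    face only, where both sides are 1. With a vertex present it reads [b0 - 1] at most the zeroth
    reduced Betti number. *)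
Lemma betti_bound :
  (b0 D + reduced_betti F D (-1) <= reduced_betti F D 0 + (set0 \in D))%N.
Proof.
have [v0|] := set_0Vmem (vertices D).
  have -> : b0 D = 0%N.
    rewrite /b0 /n_comp_mem; apply: eq_card0 => v.
    by rewrite v0 !inE andbF.
  rewrite add0n; apply: leq_trans (leq_addl _ _).
  rewrite /reduced_betti; apply: leq_trans (leq_subr _ _) _.
  by apply: leq_trans (rank_leq_row _) _; exact: card_faces_empty.
case=> v vD.
have D0 : set0 \in D by rewrite inE in vD; apply: hD vD _; exact: sub0set.
have -> : reduced_betti F D (-1) = 0%N.
  apply/eqP; rewrite /reduced_betti subn_eq0.
  apply: leq_trans (rank_leq_row _) _.
  apply: leq_trans (card_faces_empty erefl) _; rewrite D0 lt0n mxrank_eq0.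
  (* The boundary of a vertex is the empty face with coefficient 1, so the boundary matrix is
     nonzero. *)
  apply/eqP => /matrixP b0; have vf : [set v] \in faces D (-1 + 1) by exact: faces_vertex.
  have ef : set0 \in faces D (-1 + 1 - 1) by rewrite mem_faces D0 cards0.
  have := b0 (enum_rank_in vf [set v]) (enum_rank_in ef set0).
  rewrite !mxE !enum_rankK_in // incidence_set1 => /eqP.
  by rewrite oner_eq0.
rewrite addn0 D0 /reduced_betti mxrank_ker.
have h1 : (\rank (boundary F D (0 + 1)) + b0 D <= #|faces D 0|)%N.
  exact: (@rank_boundary_edges (0 + 1) erefl).
have h2 : (\rank (boundary F D 0) <= 1)%N.
  by apply: leq_trans (rank_leq_col _) _; rewrite (leq_trans (card_faces_empty _)) ?D0.
move: h1 h2; set x := \rank _; set y := \rank _; set z := #|_|; set c := b0 D.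
lia.
Qed.

End BettiBounds.

Section MuOrder.
Variables (F : fieldType) (V : finType) (D : {set {set V}}) (s : #|V|.-tuple V).
Hypothesis hD : simplicial_complex D.
Hypothesis uniq_s : uniq s.

Lemma tnth_bij : bijective (tnth s).
Proof. by apply: inj_card_bij; [exact/tuple_uniqP|rewrite card_ord]. Qed.

Lemma mem_uniq_tuple v : v \in s.
Proof. by case: tnth_bij => g _ gK; rewrite -(gK v) mem_tnth. Qed.

Lemma mu_orderE (i : int) :
  mu_order F s D i = \sum_a reduced_betti F (lower_link D s a) (i - 1).
Proof.
rewrite (reindex (tnth s)); last by case: tnth_bij => g sg gs; exists g => x _.
apply: eq_bigr => k _; congr (reduced_betti _ (link _ (induced _ _)) _).
by rewrite (tnth_nth (tnth s k)) index_uniq // size_tuple.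
Qed.

(** [betti_bound] is summed over all points of [V]; the lower link of a non-vertex is void, so the
    Boolean terms add up to at most the number of vertices. *)
Lemma kept_pairs_mu :
  #|kept_pairs D s| + mu_order F s D 0 <= mu_order F s D 1 + #|vertices D|.
Proof.
rewrite card_kept_pairs !mu_orderE -sum1_card (big_mkcond (fun a => a \in vertices D)) /=.
rewrite -!big_split /=; apply: leq_sum => a _.
apply: (@leq_trans (reduced_betti F (lower_link D s a) 0 +
  (set0 \in lower_link D s a))).
  exact: (betti_bound F (@simplicial_lower_link V D s hD a)).
rewrite leq_add2l; case: (boolP (set0 \in _)) => //.
by rewrite !inE setU0 => /and3P[_ /andP[-> _] _].
Qed.

End MuOrder.

Lemma b0_connected (V : finType) (D : {set {set V}}) :
  simplicial_complex D -> connected_complex D -> b0 D <= 1.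
Proof.
move=> hD cD; rewrite /b0 /n_comp_mem; apply/card_le1_eqP => u v.
move=> /andP[/eqP ru uD] /andP[/eqP rv vD].
by rewrite -ru -rv; apply/eqP; rewrite (root_connect (connect_edge_sym D)) cD.
Qed.

Lemma card_orderings (V : finType) :
  #|[set s : #|V|.-tuple V | uniq s]| = #|V|`!.
Proof.
rewrite -ffactnn -(card_uniq_tuples _ predT); apply: eq_card => s.
by rewrite !inE (_ : all _ _) //; exact/allP.
Qed.

From mathcomp Require Import all_classical all_reals all_analysis.
From mathcomp Require Import ring lra.

Import numFieldNormedType.Exports.
Local Open Scope classical_set_scope.
Local Open Scope ring_scope.

(** * Loops and homotopies *)

Section ContinuityTools.
Variable R : realType.

(** Retraction of the line onto the unit interval: composition with it makes a map that is
    continuous within the interval continuous everywhere. *)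
Definition clamp (x : R) : R := Num.max 0 (Num.min x 1).

Lemma clamp_ge0 x : 0 <= clamp x.
Proof. by rewrite /clamp le_max lexx. Qed.

Lemma clamp_le1 x : clamp x <= 1.
Proof. by rewrite /clamp ge_max ler01 ge_min lexx orbT. Qed.

Lemma clamp_id x : 0 <= x <= 1 -> clamp x = x.
Proof.
by move=> /andP[x0 x1]; rewrite /clamp (min_idPl x1) (max_idPr x0).
Qed.

Lemma clamp_le0 x : x <= 0 -> clamp x = 0.
Proof.
by move=> x0; rewrite /clamp (min_idPl (le_trans x0 ler01)) (max_idPl x0).
Qed.

Lemma clamp_ge1 x : 1 <= x -> clamp x = 1.
Proof. by move=> x1; rewrite /clamp (min_idPr x1) (max_idPr ler01). Qed.

Lemma continuous_clamp : continuous clamp.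
Proof.
move=> x; apply: (@continuous_max R R (cst 0) (fun x => Num.min x 1)).
  exact: cvg_cst.
by apply: (@continuous_min R R id (cst 1)); [exact: cvg_id | exact: cvg_cst].
Qed.

Lemma continuous_addf (S : topologicalType) (f g : S -> R) :
  continuous f -> continuous g -> continuous (fun x => f x + g x).
Proof. by move=> cf cg x; apply: (cvgD (cf x) (cg x)). Qed.

Lemma continuous_mulf (S : topologicalType) (f g : S -> R) :
  continuous f -> continuous g -> continuous (fun x => f x * g x).
Proof. by move=> cf cg x; apply: (cvgM (cf x) (cg x)). Qed.

Lemma continuous_oppf (S : topologicalType) (f : S -> R) :
  continuous f -> continuous (fun x => - f x).
Proof. by move=> cf x; apply: (cvgN (cf x)). Qed.

Lemma continuous_pair (S T U : topologicalType) (f : S -> T) (g : S -> U) :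
  continuous f -> continuous g -> continuous (fun x => (f x, g x)).
Proof. by move=> cf cg x; apply: (cvg_pair (cf x) (cg x)). Qed.

Lemma continuous_compf (S T U : topologicalType) (f : S -> T) (g : T -> U) :
  continuous f -> continuous g -> continuous (fun x => g (f x)).
Proof. by move=> cf cg x; apply: (continuous_comp (cf x) (cg (f x))). Qed.

(** By agreement on the overlap, the preimage of a closed set is a union of two closed sets. *)
Lemma continuous_paste (S T : topologicalType) (phi : S -> R) (c : R)
    (f g : S -> T) : continuous phi -> continuous f -> continuous g ->
  (forall x, phi x = c -> f x = g x) ->
  continuous (fun x => if phi x <= c then f x else g x).
Proof.
move=> cphi /continuous_closedP cf /continuous_closedP cg fg.
apply/continuous_closedP => A cA.
have -> : (fun x => if phi x <= c then f x else g x) @^-1` A =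
    (phi @^-1` [set y | y <= c] `&` f @^-1` A) `|`
    (phi @^-1` [set y | c <= y] `&` g @^-1` A).
  apply/seteqP; split=> x /=.
    by case: (leP (phi x) c) => [h Ax|h Ax]; [left|right; split=> //; exact: ltW].
  have [lt_c|gt_c|eq_c] := ltgtP (phi x) c; case=> -[] //.
  by rewrite (fg x eq_c).
move/continuous_closedP: cphi => cphi.
apply: closedU; apply: closedI.
- by apply: cphi; exact: closed_le.
- exact: cf.
- by apply: cphi; exact: closed_ge.
- exact: cg.
Qed.

Lemma continuous_coord (S : topologicalType) n (f : S -> 'rV[R]_n) :
  (forall j, continuous (fun x => f x ord0 j)) -> continuous f.
Proof.
move=> cf x; move=> A /= [P nP sPA].
suff : \forall y \near x, forall i j, P i j (f y i j).
  by apply: filterS => y Py; apply: sPA.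
apply: filter_forall => i; apply: filter_forall => j; rewrite (ord1 i).
exact: (cf j x _ (nP ord0 j)).
Qed.

Lemma continuous_entry n (j : 'I_n) :
  continuous (fun x : 'rV[R]_n => x ord0 j).
Proof. exact: coord_continuous. Qed.

Lemma continuous_within_comp (S T U : topologicalType) (A : set T)
    (f : T -> U) (c : S -> T) : {within A, continuous f} ->
  continuous c -> (forall x, A (c x)) -> continuous (fun x => f (c x)).
Proof.
move=> /subspace_continuousP cf cc Ac x B nB.
have h : nbhs (c x) [set y | A y -> B (f y)] := cf _ (Ac x) _ nB.
have : nbhs x (c @^-1` [set y | A y -> B (f y)]) := cc x _ h.
by apply: filterS => y /= ; apply; exact: Ac.
Qed.

Lemma uniform_continuity_unit (n : nat) (f : R -> 'rV[R]_n) (e : R) :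
  continuous f -> 0 < e ->
  exists2 d : R, 0 < d & forall s t, 0 <= s <= 1 -> `|s - t| < d ->
    forall j, `|f s ord0 j - f t ord0 j| < e.
Proof.
move=> cf e0.
have entryP j : continuous (fun x => f x ord0 j).
  exact: (continuous_compf cf (@continuous_entry _ j)).
have /compact_near_coveringP cov := @segment_compact R 0 1.
have FF : Filter (0:R)^'+ by exact: _.
have [|d /= d0 hd] := cov R (0:R)^'+ (fun d s => forall t, `|s - t| < d ->
    forall j, `|f s ord0 j - f t ord0 j| < e) FF.
  move=> s s01.
  have e20 : 0 < e / 2 by rewrite divr_gt0.
  have : \forall u \near s, forall j, `|f s ord0 j - f u ord0 j| < e / 2.
    apply: (@filter_forall _ _ (fun j u => `|f s ord0 j - f u ord0 j| < e / 2)
      _ (nbhs_filter s)).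
    move=> j.
    by have /cvgrPdist_lt := entryP j s; apply.
  move=> /nbhs_ballP [d /= d0 hd].
  have d20 : 0 < d / 2 by rewrite divr_gt0.
  (* Half of [d] for the centre and half for the step keep [u] and [t] within [d] of [s], where each
     coordinate of [f] moves by less than [e / 2]. *)
  exists (ball s (d/2), [set x : R | x < d / 2]).
    split => /=; first exact: nbhsx_ballx.
    exact: nbhs_right_lt.
  move=> [u x] [/= su xd] t ut j.
  have h1 : `|f s ord0 j - f u ord0 j| < e / 2.
    by apply: (hd u); rewrite /ball/= in su *; lra.
  have h2 : `|f s ord0 j - f t ord0 j| < e / 2.
    apply: (hd t); rewrite /ball/= in su *.
    have := ler_normD (s - u) (u - t).
    have -> : s - u + (u - t) = s - t by ring.
    lra.
  have := ler_normD (f u ord0 j - f s ord0 j) (f s ord0 j - f t ord0 j).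
  rewrite (distrC (f u ord0 j)).
  have -> : f u ord0 j - f s ord0 j + (f s ord0 j - f t ord0 j) =
    f u ord0 j - f t ord0 j by ring.
  lra.
exists (d / 2); first by rewrite divr_gt0.
move=> s t s01; apply: (hd (d/2)) => //=; rewrite ?divr_gt0//.
  rewrite sub0r normrN ger0_norm ?divr_ge0// ?ltW//; lra.
Qed.

End ContinuityTools.

Section Loops.
Variables (R : realType) (T : topologicalType) (X : set T) (x0 : T).
Implicit Types (f g h : R -> T).
Local Notation loop := (loop X x0).
Local Notation loop_homotopic := (loop_homotopic X x0).
Local Notation loop_class := (loop_class X x0).
Local Notation clamp := (@clamp R).

Let clamp0 : clamp 0 = 0. Proof. by rewrite clamp_le0. Qed.
Let clamp1 : clamp 1 = 1. Proof. by rewrite clamp_ge1. Qed.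

Lemma mem_unit_square (s t : R) :
  0 <= s <= 1 -> 0 <= t <= 1 -> unit_square (s, t).
Proof. by move=> s01 t01; split; rewrite /= in_itv. Qed.

Lemma clamp_unit s : 0 <= clamp s <= 1.
Proof. by rewrite clamp_ge0 clamp_le1. Qed.

Lemma loop_continuous f : loop f -> continuous (fun t => f (clamp t)).
Proof.
case=> cf _ _ _; apply: (continuous_within_comp cf).
  exact: continuous_clamp.
by move=> x; rewrite /= in_itv /= clamp_unit.
Qed.

Lemma loop_sub f t : loop f -> 0 <= t <= 1 -> X (f t).
Proof. by case=> _ sX _ _ t01; apply: sX; exists t => //=; rewrite in_itv. Qed.

Lemma loop_sub_clamp f t : loop f -> X (f (clamp t)).
Proof. by move=> lf; apply: loop_sub => //; exact: clamp_unit. Qed.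

Lemma loop_of_continuous f : continuous f ->
  (forall t, 0 <= t <= 1 -> X (f t)) -> f 0 = x0 -> f 1 = x0 -> loop f.
Proof.
move=> cf Xf f0 f1; split => //; first exact: continuous_subspaceT.
by move=> _ [t /= t01 <-]; apply: Xf; rewrite in_itv in t01.
Qed.

Lemma homotopic_intro f g (H : R * R -> T) : continuous H ->
  (forall s t, 0 <= s <= 1 -> 0 <= t <= 1 -> X (H (s, t))) ->
  (forall s, 0 <= s <= 1 -> H (s, 0) = f s) ->
  (forall s, 0 <= s <= 1 -> H (s, 1) = g s) ->
  (forall t, 0 <= t <= 1 -> H (0, t) = x0) ->
  (forall t, 0 <= t <= 1 -> H (1, t) = x0) ->
  loop_homotopic f g.
Proof.
move=> cH XH Hf Hg H0 H1; exists H; split => //.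
- exact: continuous_subspaceT.
- move=> _ [[s t] [/= + +] <-]; rewrite !in_itv /= => *; exact: XH.
- by move=> t t01; split; [exact: H0|exact: H1].
Qed.

(* Precomposing with [clamp] makes the homotopy continuous on the whole plane. *)
Lemma homotopic_elim f g : loop_homotopic f g ->
  exists H : R -> R -> T,
    [/\ continuous (fun p : R * R => H p.1 p.2), forall s t, X (H s t),
        forall s, H s 0 = f (clamp s), forall s, H s 1 = g (clamp s) &
        forall t, H 0 t = x0 /\ H 1 t = x0].
Proof.
case=> H [cH XH Hf Hg Hx].
exists (fun s t => H (clamp s, clamp t)); split.
- apply: (continuous_within_comp (c := fun p => (clamp p.1, clamp p.2)) cH).
    apply: continuous_pair.
      by apply: (continuous_compf _ (@continuous_clamp R)) => x; exact: cvg_fst.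
    by apply: (continuous_compf _ (@continuous_clamp R)) => x; exact: cvg_snd.
  by case=> s t; apply: mem_unit_square; exact: clamp_unit.
- move=> s t; apply: XH; exists (clamp s, clamp t) => //.
  by apply: mem_unit_square; exact: clamp_unit.
- by move=> s; rewrite clamp0 Hf ?clamp_unit.
- by move=> s; rewrite clamp1 Hg ?clamp_unit.
- by move=> t; rewrite clamp0 clamp1; apply: Hx; exact: clamp_unit.
Qed.

Lemma continuous_fst2 : continuous (fun p : R * R => p.1).
Proof. by move=> x; exact: cvg_fst. Qed.

Lemma continuous_snd2 : continuous (fun p : R * R => p.2).
Proof. by move=> x; exact: cvg_snd. Qed.

Lemma continuous_affine (S : topologicalType) (phi : S -> R) (a b : R) :
  continuous phi -> continuous (fun x => a * phi x + b).
Proof.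
move=> cphi; apply: continuous_addf; last by move=> x; exact: cvg_cst.
by apply: continuous_mulf => // x; exact: cvg_cst.
Qed.

(** Loops are functions on the whole line of which only the values on the unit interval count, so
    this plays the part of equality. *)
Lemma homotopic_eq f g : loop f -> (forall t, 0 <= t <= 1 -> f t = g t) ->
  loop_homotopic f g.
Proof.
move=> lf fg; have [_ _ f0 f1] := lf.
apply: (@homotopic_intro _ _ (fun p => f (clamp p.1))).
- exact: (continuous_compf continuous_fst2 (loop_continuous lf)).
- by move=> *; exact: loop_sub_clamp.
- by move=> s s01 /=; rewrite clamp_id.
- by move=> s s01 /=; rewrite clamp_id // fg.
- by move=> *; rewrite /= clamp0.
- by move=> *; rewrite /= clamp1.
Qed.

Lemma homotopic_refl f : loop f -> loop_homotopic f f.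
Proof. by move=> lf; exact: homotopic_eq. Qed.

Lemma homotopic_sym f g : loop_homotopic f g -> loop_homotopic g f.
Proof.
move=> /homotopic_elim[H [cH XH Hf Hg Hx]].
apply: (@homotopic_intro _ _ (fun p => H p.1 (-1 * p.2 + 1))).
- apply: (continuous_compf (f := fun p : R * R => (p.1, -1 * p.2 + 1)) _ cH).
  apply: continuous_pair; first exact: continuous_fst2.
  exact/continuous_affine/continuous_snd2.
- by [].
- by move=> s s01 /=; rewrite mulr0 add0r Hg clamp_id.
- by move=> s s01 /=; rewrite mulr1 addNr Hf clamp_id.
- by move=> t _; case: (Hx (-1 * t + 1)).
- by move=> t _; case: (Hx (-1 * t + 1)).
Qed.

Lemma homotopic_trans g f h :
  loop_homotopic f g -> loop_homotopic g h -> loop_homotopic f h.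
Proof.
move=> /homotopic_elim[H [cH XH Hf Hg Hx]] /homotopic_elim[K [cK XK Kf Kg Kx]].
apply: (@homotopic_intro _ _ (fun p =>
  if p.2 <= 2^-1 then H p.1 (2 * p.2 + 0) else K p.1 (2 * p.2 + -1))).
- apply: continuous_paste; first exact: continuous_snd2.
  + apply: (continuous_compf (f := fun p : R * R => (p.1, 2 * p.2 + 0)) _ cH).
    apply: continuous_pair; first exact: continuous_fst2.
    exact/continuous_affine/continuous_snd2.
  + apply: (continuous_compf (f := fun p : R * R => (p.1, 2 * p.2 + -1)) _ cK).
    apply: continuous_pair; first exact: continuous_fst2.
    exact/continuous_affine/continuous_snd2.
  + by move=> p ->; rewrite addr0 mulfV // subrr Hg Kf.
- by move=> s t _ _ /=; case: ifP.
- by move=> s s01 /=; rewrite invr_ge0 ler0n mulr0 addr0 Hf clamp_id.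
- move=> s s01 /=; rewrite ifF; last by apply/negP; lra.
  by rewrite (_ : 2 * 1 + -1 = 1); [rewrite Kg clamp_id|lra].
- by move=> t _ /=; case: ifP => _; [case: (Hx (2 * t + 0))|case: (Kx (2 * t + -1))].
- by move=> t _ /=; case: ifP => _; [case: (Hx (2 * t + 0))|case: (Kx (2 * t + -1))].
Qed.

Lemma homotopic_concat f f' g g' :
  loop_homotopic f f' -> loop_homotopic g g' ->
  loop_homotopic (loop_concat f g) (loop_concat f' g').
Proof.
move=> /homotopic_elim[H [cH XH Hf Hg Hx]] /homotopic_elim[K [cK XK Kf Kg Kx]].
apply: (@homotopic_intro _ _ (fun p =>
  if p.1 <= 2^-1 then H (2 * p.1 + 0) p.2 else K (2 * p.1 + -1) p.2)).
- apply: continuous_paste; first exact: continuous_fst2.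
  + apply: (continuous_compf (f := fun p : R * R => (2 * p.1 + 0, p.2)) _ cH).
    apply: continuous_pair; last exact: continuous_snd2.
    exact/continuous_affine/continuous_fst2.
  + apply: (continuous_compf (f := fun p : R * R => (2 * p.1 + -1, p.2)) _ cK).
    apply: continuous_pair; last exact: continuous_snd2.
    exact/continuous_affine/continuous_fst2.
  + move=> p ->; rewrite addr0 mulfV // subrr.
    by case: (Hx p.2) (Kx p.2) => _ -> [-> _].
- by move=> s t _ _ /=; case: ifP.
- move=> s s01 /=; rewrite /loop_concat; case: leP => s2.
    by rewrite Hf addr0 clamp_id //; lra.
  by rewrite Kf clamp_id //; lra.
- move=> s s01 /=; rewrite /loop_concat; case: leP => s2.
    by rewrite Hg addr0 clamp_id //; lra.
  by rewrite Kg clamp_id //; lra.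
- move=> t _ /=; rewrite invr_ge0 ler0n mulr0 addr0.
  by case: (Hx t).
- move=> t _ /=; rewrite ifF; last by apply/negP; lra.
  rewrite (_ : 2 * 1 + -1 = 1); last by lra.
  by case: (Kx t).
Qed.

Lemma homotopic_rev f g :
  loop_homotopic f g -> loop_homotopic (loop_rev f) (loop_rev g).
Proof.
move=> /homotopic_elim[H [cH XH Hf Hg Hx]].
apply: (@homotopic_intro _ _ (fun p => H (-1 * p.1 + 1) p.2)).
- apply: (continuous_compf (f := fun p : R * R => (-1 * p.1 + 1, p.2)) _ cH).
  apply: continuous_pair; last exact: continuous_snd2.
  exact/continuous_affine/continuous_fst2.
- by [].
- move=> s s01 /=; rewrite Hf clamp_id; last lra.
  by rewrite /loop_rev mulN1r addrC.
- move=> s s01 /=; rewrite Hg clamp_id; last lra.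
  by rewrite /loop_rev mulN1r addrC.
- by move=> t _; rewrite /= mulr0 add0r; case: (Hx t).
- by move=> t _; rewrite /= mulr1 addNr; case: (Hx t).
Qed.

Lemma loop_class_eq f g : loop_homotopic f g -> loop_class f = loop_class g.
Proof.
move=> fg; apply/seteqP; split=> h [lh hh]; split=> //.
  exact: homotopic_trans (homotopic_sym fg) hh.
exact: homotopic_trans fg hh.
Qed.

Lemma pi1_mul_class f g : loop f -> loop g ->
  pi1_mul X x0 (loop_class f) (loop_class g) = loop_class (loop_concat f g).
Proof.
move=> lf lg; apply/seteqP; split=> h.
  case=> f' [g' [[lf' ff'] [lg' gg'] [lh fgh]]]; split=> //.
  exact: homotopic_trans (homotopic_concat ff' gg') fgh.
move=> hh; exists f, g; split=> //.
  by split=> //; exact: homotopic_refl.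
by split=> //; exact: homotopic_refl.
Qed.

Lemma pi1_inv_class f : loop f ->
  pi1_inv X x0 (loop_class f) = loop_class (loop_rev f).
Proof.
move=> lf; apply/seteqP; split=> h.
  case=> f' [lf' ff'] [lh fh]; split=> //.
  exact: homotopic_trans (homotopic_rev ff') fh.
by move=> hh; exists f => //; split=> //; exact: homotopic_refl.
Qed.

End Loops.

(** * Walks in the geometric realization *)

Section Polyline.
Variables (R : realType) (V : finType).
Implicit Types (D : {set {set V}}) (x y : 'rV[R]_#|V|) (a b c u v : V).
Implicit Types (p q : seq V) (s t : R).
Local Notation clamp := (@clamp R).
Local Notation pt := (@vertex_point R V).

Definition support_set x : {set V} := [set v | x ord0 (enum_rank v) != 0]%SET.

Definition same_simplex D x y :=
  exists A, [/\ A \in D, support_set x \subset A & support_set y \subset A].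

Lemma same_simplexxx D x : realization D x -> same_simplex D x x.
Proof. by case=> _ _ xD; exists (support_set x). Qed.

Lemma support_set_conv x y s t (A : {set V}) :
  support_set x \subset A -> support_set y \subset A ->
  support_set (s *: x + t *: y) \subset A.
Proof.
move=> /fintype.subsetP xA /fintype.subsetP yA; apply/fintype.subsetP => v.
rewrite inE !mxE => h.
have [x0|] := eqVneq (x ord0 (enum_rank v)) 0; last by move=> ?; apply: xA; rewrite inE.
have [y0|] := eqVneq (y ord0 (enum_rank v)) 0; last by move=> ?; apply: yA; rewrite inE.
by rewrite x0 y0 !mulr0 addr0 eqxx in h.
Qed.

Lemma realization_conv D x y t : simplicial_complex D ->
  realization D x -> realization D y -> same_simplex D x y -> 0 <= t <= 1 ->
  realization D ((1 - t) *: x + t *: y).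
Proof.
move=> hD [x0 x1 _] [y0 y1 _] [A [AD xA yA]] /andP[t0 t1]; split.
- by move=> j; rewrite !mxE addr_ge0 // mulr_ge0 // subr_ge0.
- transitivity (\sum_j ((1 - t) * x ord0 j + t * y ord0 j)).
    by apply: eq_bigr => j _; rewrite !mxE.
  by rewrite big_split -!mulr_sumr /= x1 y1; ring.
- exact: hD AD (support_set_conv _ _ xA yA).
Qed.

Lemma pt_entry u v : pt u ord0 (enum_rank v) = (v == u)%:R.
Proof. by rewrite mxE eqxx /= (inj_eq enum_rank_inj). Qed.

Lemma support_set_pt u : support_set (pt u) = [set u]%SET.
Proof.
by apply/finset.setP => v; rewrite !inE pt_entry pnatr_eq0 eqb0 negbK.
Qed.

Lemma realization_pt D u : u \in vertices D -> realization D (pt u).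
Proof.
rewrite inE => uD; split.
- by move=> j; rewrite mxE ler0n.
- rewrite (bigD1 (enum_rank u)) //= big1 ?addr0.
    by rewrite mxE !eqxx.
  by move=> j ju; rewrite mxE (negPf ju) andbF.
- by rewrite -[X in X \in D]/(support_set (pt u)) support_set_pt.
Qed.

Lemma support_set_segment u v s t (A : {set V}) : u \in A -> v \in A ->
  support_set (s *: pt u + t *: pt v) \subset A.
Proof.
by move=> uA vA; apply: support_set_conv; rewrite support_set_pt finset.sub1set.
Qed.

(* At integer times the polyline visits the vertices of the walk; it is constant
   before time 0 and after time [size p]. *)
Fixpoint polyline a p t : 'rV[R]_#|V| :=
  if p is b :: q then
    clamp t *: (pt b - pt a) + (pt a - pt b) + polyline b q (t - 1)
  else pt a.

(** The hypothesis on the tail lets the induction of [polyline_le0] use this formula, after which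
    [polyline_le1] discharges it. *)
Lemma polyline_cons_le1 a b q t : (forall s, s <= 0 -> polyline b q s = pt b) ->
  t <= 1 -> polyline a (b :: q) t = (1 - clamp t) *: pt a + clamp t *: pt b.
Proof.
move=> hq t1; rewrite /= hq ?subr_le0 //.
by rewrite scalerBr scalerBl scale1r; apply/rowP => j; rewrite !mxE; ring.
Qed.

Lemma polyline_le0 a p t : t <= 0 -> polyline a p t = pt a.
Proof.
elim: p a t => // b q IH a t t0; rewrite polyline_cons_le1.
- by rewrite clamp_le0 // subr0 scale1r scale0r addr0.
- by move=> s; exact: IH.
- exact: le_trans t0 ler01.
Qed.

Lemma polyline_le1 a b q t : t <= 1 ->
  polyline a (b :: q) t = (1 - clamp t) *: pt a + clamp t *: pt b.
Proof. by apply: polyline_cons_le1 => s; exact: polyline_le0. Qed.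

Lemma polyline_ge1 a b q t : 1 <= t -> polyline a (b :: q) t = polyline b q (t - 1).
Proof.
move=> t1; rewrite /= clamp_ge1 // scale1r.
by apply/rowP => j; rewrite !mxE; ring.
Qed.

(** At each time one of the two summands rests at the common vertex, which is subtracted. *)
Lemma polyline_cat a p q t : polyline a (p ++ q) t =
  polyline a p t + polyline (last a p) q (t - (size p)%:R) - pt (last a p).
Proof.
elim: p a t => [|b p IH] a t /=.
  by rewrite subr0 addrAC subrr add0r.
have -> : t - (size p).+1%:R = t - 1 - (size p)%:R by rewrite -natr1; ring.
by rewrite IH !addrA.
Qed.

Lemma polyline_ge_size a p t : (size p)%:R <= t -> polyline a p t = pt (last a p).
Proof.
elim: p a t => // b q IH a t; rewrite /= -natr1 => tq.
have q0 : (0 : R) <= (size q)%:R by rewrite ler0n.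
rewrite -[LHS]/(polyline a (b :: q) t) polyline_ge1 ?IH //; lra.
Qed.

(** The additive form of [polyline] has no case distinction on time, so continuity reduces to that
    of [clamp]. *)
Lemma polyline_continuous a p : continuous (polyline a p).
Proof.
elim: p a => [|b q IH] a; first by move=> x; exact: cvg_cst.
apply: continuous_coord => j.
have -> : (fun t => polyline a (b :: q) t ord0 j) = (fun t =>
    clamp t * (pt b ord0 j - pt a ord0 j) + (pt a ord0 j - pt b ord0 j) +
    polyline b q (t - 1) ord0 j).
  by apply/funext => t; rewrite !mxE.
apply: continuous_addf.
  apply: continuous_addf; last by move=> x; exact: cvg_cst.
  apply: continuous_mulf; first exact: continuous_clamp.
  by move=> x; exact: cvg_cst.
apply: (continuous_compf (f := fun t : R => t - 1)
   (g := fun t => polyline b q t ord0 j)).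
  apply: continuous_addf; first by move=> x; exact: cvg_id.
  by move=> x; exact: cvg_cst.
exact: (continuous_compf (IH b) (@continuous_entry _ _ j)).
Qed.

Lemma polyline_realization D a p t : simplicial_complex D ->
  a \in vertices D -> path (edge D) a p -> realization D (polyline a p t).
Proof.
move=> hD; elim: p a t => [|b q IH] a t av; first by move=> _; exact: realization_pt.
move=> /= /andP[ab bq].
have bv := edge_vertex hD ab.
have [t1|t1] := leP t 1; last first.
  rewrite -[X in realization D X]/(polyline a (b :: q) t) polyline_ge1 ?ltW //.
  exact: IH.
rewrite -[X in realization D X]/(polyline a (b :: q) t) polyline_le1 //.
apply: realization_conv => //; try exact: realization_pt.
  exists [set a; b]%SET.
  by split=> //; rewrite support_set_pt finset.sub1set !inE eqxx ?orbT.
by rewrite clamp_ge0 clamp_le1.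
Qed.

Lemma polyline_segment a p t : 0 <= t <= (size p)%:R -> (0 < size p)%N ->
  exists i, [/\ (i < size p)%N, i%:R <= t, t <= i.+1%:R &
    exists s, polyline a p t =
      (1 - s) *: pt (nth a (a :: p) i) + s *: pt (nth a (a :: p) i.+1)].
Proof.
elim: p a t => // b q IH a t /= /andP[t0 tq] _.
have [t1|t1] := leP t 1.
  by exists 0%N; split=> //; exists (clamp t); exact: polyline_le1.
have q0 : (0 < size q)%N.
  rewrite lt0n; apply/eqP => q0; move: tq; rewrite q0 => ?; lra.
have tq1 : 0 <= t - 1 <= (size q)%:R.
  by move: tq; rewrite -natr1 => ?; apply/andP; split; lra.
have [i [iq it ti [s hs]]] := IH b (t - 1) tq1 q0.
exists i.+1; split=> //.
- by rewrite -natr1; lra.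
- by rewrite -natr1; lra.
exists s; rewrite -[LHS]/(polyline a (b :: q) t) polyline_ge1 ?ltW // hs.
by rewrite -![nth a (a :: b :: q) _.+1]/(nth a (b :: q) _)
  !(set_nth_default b a) //= ltnS // ltnW.
Qed.

Lemma polyline_rev a p t :
  polyline (last a p) (rev_walk a p) t = polyline a p ((size p)%:R - t).
Proof.
elim: p a t => [|b q IH] a t //.
rewrite rev_walk_cons [last a _]/= -cats1 polyline_cat IH last_rev_walk.
rewrite /rev_walk size_rev size_belast /= -natr1.
have -> : (size q)%:R + 1 - t - 1 = (size q)%:R - t by ring.
have -> : clamp ((size q)%:R + 1 - t) = 1 - clamp (t - (size q)%:R).
  set y := t - (size q)%:R; have -> : (size q)%:R + 1 - t = 1 - y by rewrite /y; ring.
  have [y0|y0] := leP y 0.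
    by rewrite clamp_ge1 ?(clamp_le0 y0) ?subr0 //; lra.
  have [y1|y1] := leP y 1; last by rewrite clamp_le0 ?clamp_ge1 ?subrr //; lra.
  by rewrite !clamp_id //; lra.
by apply/rowP => j; rewrite !mxE; ring.
Qed.

End Polyline.

Section WalkLoops.
Variables (R : realType) (V : finType) (D : {set {set V}}) (r : V).
Hypothesis hD : simplicial_complex D.
Hypothesis rD : r \in vertices D.
Implicit Types (p q : seq V) (s t : R).
Local Notation X := (@realization R V D).
Local Notation pt := (@vertex_point R V).
Local Notation clamp := (@clamp R).
Local Notation loop := (loop X (pt r)).
Local Notation loop_homotopic := (loop_homotopic X (pt r)).
Local Notation loop_class := (loop_class X (pt r)).

Definition walk_loop p : R -> 'rV[R]_#|V| :=
  fun t => polyline r p ((size p)%:R * t).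

Lemma reparam_continuous p (phi : R -> R) :
  continuous phi -> continuous (fun t => polyline r p (phi t)).
Proof. move=> cphi; exact: (continuous_compf cphi (@polyline_continuous R V r p)). Qed.

Lemma reparam_loop p (phi : R -> R) : closed_walk D r p ->
  continuous phi -> phi 0 <= 0 -> (size p)%:R <= phi 1 ->
  loop (fun t => polyline r p (phi t)).
Proof.
move=> /andP[wp /eqP lp] cphi phi0 phi1; apply: loop_of_continuous.
- exact: reparam_continuous.
- by move=> t _; exact: polyline_realization.
- by rewrite polyline_le0.
- by rewrite polyline_ge_size // lp.
Qed.

(** Interpolating times instead of points keeps the homotopy on the polyline. The end conditions are
    inequalities because a polyline rests outside its time span. *)
Lemma reparam_homotopic p (phi psi : R -> R) : closed_walk D r p ->
  continuous phi -> phi 0 <= 0 -> (size p)%:R <= phi 1 ->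
  continuous psi -> psi 0 <= 0 -> (size p)%:R <= psi 1 ->
  loop_homotopic (fun t => polyline r p (phi t))
                 (fun t => polyline r p (psi t)).
Proof.
move=> /andP[wp /eqP lp] cphi phi0 phi1 cpsi psi0 psi1.
apply: (@homotopic_intro _ _ _ _ _ _ (fun u : R * R => polyline r p
  ((-1 * u.2 + 1) * phi u.1 + u.2 * psi u.1))).
- apply: (continuous_compf (f := fun u : R * R =>
    (-1 * u.2 + 1) * phi u.1 + u.2 * psi u.1) _ (@polyline_continuous R V r p)).
  apply: continuous_addf; apply: continuous_mulf.
  + exact/continuous_affine/continuous_snd2.
  + exact: (continuous_compf (@continuous_fst2 R) cphi).
  + exact: continuous_snd2.
  + exact: (continuous_compf (@continuous_fst2 R) cpsi).
- by move=> *; exact: polyline_realization.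
- by move=> s _ /=; congr polyline; ring.
- by move=> s _ /=; congr polyline; ring.
- move=> t t01; rewrite polyline_le0 //=; nra.
- move=> t t01; rewrite polyline_ge_size //= ?lp //; nra.
Qed.

Lemma mul_continuous (k : R) : continuous (fun t : R => k * t).
Proof. by apply: continuous_mulf => x; [exact: cvg_cst|exact: cvg_id]. Qed.

Lemma walk_loop_continuous p : continuous (walk_loop p).
Proof. by apply: reparam_continuous; exact: mul_continuous. Qed.

Lemma walk_loop_loop p : closed_walk D r p -> loop (walk_loop p).
Proof.
move=> wp; apply: (@reparam_loop p (fun t => (size p)%:R * t)) => //=;
  rewrite ?mulr0 ?mulr1 //.
exact: mul_continuous.
Qed.

Lemma straight_line_homotopic (f g : R -> 'rV[R]_#|V|) : continuous f -> continuous g ->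
  f 0 = pt r -> g 0 = pt r -> f 1 = pt r -> g 1 = pt r ->
  (forall t, 0 <= t <= 1 -> X (f t)) -> (forall t, 0 <= t <= 1 -> X (g t)) ->
  (forall t, 0 <= t <= 1 -> same_simplex D (f t) (g t)) ->
  loop_homotopic f g.
Proof.
move=> cf cg f0 g0 f1 g1 Xf Xg fg.
have entry (h : R -> 'rV[R]_#|V|) : continuous h -> forall j,
    continuous (fun u : R * R => h u.1 ord0 j : R).
  move=> ch j; apply: (continuous_compf (g := fun t => h t ord0 j) (@continuous_fst2 R)).
  exact: (continuous_compf ch (@continuous_entry _ _ j)).
apply: (@homotopic_intro _ _ _ _ _ _
  (fun u : R * R => (1 - u.2) *: f u.1 + u.2 *: g u.1)).
- apply: continuous_coord => j.
  have -> : (fun u : R * R => ((1 - u.2) *: f u.1 + u.2 *: g u.1) ord0 j) =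
    (fun u => (-1 * u.2 + 1) * f u.1 ord0 j + u.2 * g u.1 ord0 j).
    by apply/funext => u; rewrite !mxE; ring.
  apply: continuous_addf; apply: continuous_mulf; try exact: entry.
    exact/continuous_affine/continuous_snd2.
  exact: continuous_snd2.
- move=> s t s01 t01; apply: realization_conv => //; [exact: Xf|exact: Xg|exact: fg].
- by move=> s _ /=; rewrite subr0 scale1r scale0r addr0.
- by move=> s _ /=; rewrite subrr scale1r scale0r add0r.
- by move=> t _ /=; rewrite f0 g0 -scalerDl subrK scale1r.
- by move=> t _ /=; rewrite f1 g1 -scalerDl subrK scale1r.
Qed.

(** Replacing [b] by a repetition of [last a p], instead of deleting it, keeps the two polylines
    synchronous. *)
Lemma polyline_triangle a p b c q t : a \in vertices D ->
  [set last a p; b; c]%SET \in D ->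
  path (edge D) a (p ++ c :: q) ->
  same_simplex D (polyline a (p ++ b :: c :: q) t)
                 (polyline a (p ++ last a p :: c :: q) t).
Proof.
elim: p a t => [|d p IH] a t av abc wp.
  rewrite !cat0s [last _ _]/=; have [t1|t1] := leP t 1.
    rewrite !polyline_le1 //; exists [set a; b; c]%SET; split=> //;
    by apply: support_set_segment; rewrite !inE eqxx ?orbT.
  rewrite !(@polyline_ge1 R V _ _ _ t (ltW t1)).
  have [t2|t2] := leP (t - 1) 1.
    rewrite !polyline_le1 //; exists [set a; b; c]%SET; split=> //;
    by apply: support_set_segment; rewrite !inE eqxx ?orbT.
  rewrite !(@polyline_ge1 R V _ _ _ _ (ltW t2)); apply: same_simplexxx.
  case/andP: wp => ac cq.
  by apply: polyline_realization => //; exact: edge_vertex ac.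
case/andP: (wp) => ad dp.
have dv : d \in vertices D by exact: edge_vertex ad.
have [t1|t1] := leP t 1.
  rewrite !cat_cons !polyline_le1 //; exists [set a; d]%SET; split=> //;
  by apply: support_set_segment; rewrite !inE eqxx ?orbT.
rewrite !cat_cons !(@polyline_ge1 R V _ _ _ _ (ltW t1)); exact: IH.
Qed.

Lemma walk_loop_stutter p q : closed_walk D r (p ++ q) ->
  loop_homotopic (walk_loop (p ++ last r p :: q)) (walk_loop (p ++ q)).
Proof.
move=> wpq.
pose n : R := (size p)%:R; pose m : R := (size q)%:R.
(* In the time of the longer walk, [phi] advances up to [n], waits there for one unit, and goes
   on. *)
pose phi t := (n + m + 1) * t - clamp ((n + m + 1) * t - n).
have n0 : 0 <= n by rewrite ler0n.
have m0 : 0 <= m by rewrite ler0n.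
have cphi : continuous phi.
  apply: continuous_addf; first exact: mul_continuous.
  apply: continuous_oppf.
  apply: (continuous_compf (f := fun t => (n + m + 1) * t + (- n))).
    by apply: continuous_affine => x; exact: cvg_id.
  exact: continuous_clamp.
have -> : walk_loop (p ++ last r p :: q) = (fun t => polyline r (p ++ q) (phi t)).
  apply/funext => t; rewrite /walk_loop size_cat /= addnS -natr1 natrD.
  rewrite /phi -/n -/m; set y := (n + m + 1) * t.
  rewrite !polyline_cat -/n /=.
  have [yn|yn] := leP y n.
    rewrite clamp_le0; last lra.
    rewrite subr0 !(@polyline_le0 _ _ _ q) ?subrr ?scaler0 ?add0r //; lra.
  rewrite polyline_ge_size ?ltW //.
  have [yn1|yn1] := leP y (n + 1).
    rewrite clamp_id; last lra.
    have -> : y - (y - n) = n by ring.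
    rewrite (@polyline_ge_size _ _ _ p n) // !(@polyline_le0 _ _ _ q) ?subrr //; last lra.
    by rewrite scaler0 !add0r.
  rewrite clamp_ge1; last lra.
  rewrite (@polyline_ge_size _ _ _ p); last by rewrite -/n; lra.
  have -> : y - 1 - n = y - n - 1 by ring.
  by rewrite subrr scaler0 !add0r.
have -> : walk_loop (p ++ q) = (fun t => polyline r (p ++ q) ((n + m) * t)).
  by apply/funext => t; rewrite /walk_loop size_cat natrD.
have sz : (size (p ++ q))%:R = n + m :> R by rewrite size_cat natrD.
apply: (@reparam_homotopic _ phi (fun t => (n + m) * t)) => //=; rewrite ?sz.
- by rewrite /phi mulr0 clamp_le0 ?subr0 // sub0r oppr_le0.
- by rewrite /phi mulr1; have := clamp_le1 (n + m + 1 - n); lra.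
- exact: mul_continuous.
- by rewrite mulr0.
- by rewrite mulr1.
Qed.

Lemma walk_eq_homotopic p q : walk_eq D r p q -> closed_walk D r p ->
  loop_homotopic (walk_loop p) (walk_loop q).
Proof.
move=> pq; elim: pq => {p q}.
- by move=> p wp; apply/homotopic_refl/walk_loop_loop.
- by move=> p q pq IH wq; apply: homotopic_sym; apply: IH;
    rewrite (walk_eq_closed hD rD pq).
- move=> q p s pq IH qs IH' wp; apply: homotopic_trans (IH wp) (IH' _).
  by rewrite -(walk_eq_closed hD rD pq).
- move=> p b c q abc wp.
  have w1 : closed_walk D r (p ++ c :: q).
    by rewrite -(walk_eq_closed hD rD (walk_eq_triangle q abc)).
  have w2 : closed_walk D r (p ++ last r p :: c :: q).
    by rewrite (walk_eq_closed hD rD (walk_eq_stutter D r p (c :: q))).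
  (* The triangle move is a straight-line homotopy to the synchronous walk followed by the removal
     of a stutter. *)
  apply: homotopic_trans _ (walk_loop_stutter w1).
  have [_ _ f0 f1] := walk_loop_loop wp.
  have [_ _ g0 g1] := walk_loop_loop w2.
  case/andP: (wp) => pp _; case/andP: (w1) => pp1 _; case/andP: (w2) => pp2 _.
  apply: straight_line_homotopic => //.
  + exact: walk_loop_continuous.
  + exact: walk_loop_continuous.
  + by move=> t _; exact: polyline_realization.
  + by move=> t _; exact: polyline_realization.
  + move=> t _; rewrite /walk_loop !size_cat /=.
    exact: polyline_triangle.
- move=> p q wp; apply: walk_loop_stutter.
  by rewrite -(walk_eq_closed hD rD (walk_eq_stutter D r p q)).
Qed.

Lemma walk_loop_cat p q : closed_walk D r p -> closed_walk D r q ->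
  loop_homotopic (loop_concat (walk_loop p) (walk_loop q)) (walk_loop (p ++ q)).
Proof.
move=> wp wq; have wpq := closed_walk_cat wp wq.
pose n : R := (size p)%:R; pose m : R := (size q)%:R.
have n0 : 0 <= n by rewrite ler0n.
have m0 : 0 <= m by rewrite ler0n.
(* A concatenation gives each walk half of the time whatever its length; [phi] is the resulting time
   on the joint polyline. *)
pose phi t := n * clamp (2 * t) + m * clamp (2 * t - 1).
have cphi : continuous phi.
  apply: continuous_addf; apply: continuous_mulf;
    try by move=> x; exact: cvg_cst.
    exact: (continuous_compf (@mul_continuous 2) (@continuous_clamp R)).
  apply: (continuous_compf _ (@continuous_clamp R)).
  by apply: continuous_affine => x; exact: cvg_id.
have sz : (size (p ++ q))%:R = n + m :> R by rewrite size_cat natrD.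
have phi0 : phi 0 <= 0.
  by rewrite /phi mulr0 !clamp_le0 ?mulr0 ?addr0 // sub0r oppr_le0.
have phi1 : (size (p ++ q))%:R <= phi 1.
  by rewrite sz /phi mulr1 !clamp_ge1 ?mulr1 //; lra.
apply: (@homotopic_trans _ _ _ _ (fun t => polyline r (p ++ q) (phi t))); last first.
  apply: (@reparam_homotopic _ phi (fun t => (size (p ++ q))%:R * t)) => //=;
    rewrite ?mulr0 ?mulr1 //.
  exact: mul_continuous.
apply: homotopic_sym; apply: homotopic_eq; first exact: reparam_loop.
move=> t t01; case/andP: wp => _ /eqP lp.
rewrite polyline_cat lp /loop_concat /walk_loop /phi -/n -/m; case: leP => t2.
  rewrite (clamp_id (x := 2 * t)); last lra.
  rewrite (clamp_le0 (x := 2 * t - 1)); last lra.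
  rewrite mulr0 addr0 (@polyline_le0 _ _ _ q) ?addrK //; nra.
rewrite (clamp_ge1 (x := 2 * t)); last lra.
rewrite (clamp_id (x := 2 * t - 1)); last lra.
rewrite mulr1 (@polyline_ge_size _ _ _ p); last by rewrite -/n; nra.
by rewrite lp addrAC subrr add0r addrAC subrr add0r.
Qed.

Lemma walk_loop_rev p : closed_walk D r p ->
  loop_rev (walk_loop p) = walk_loop (rev_walk r p).
Proof.
case/andP=> _ /eqP lp; apply/funext => t.
rewrite /loop_rev /walk_loop /rev_walk size_rev size_belast mulrBr mulr1.
by rewrite -polyline_rev lp.
Qed.

End WalkLoops.

(** * Simplicial approximation of loops *)

Section Approximation.
Variables (R : realType) (V : finType) (D : {set {set V}}) (r : V).
Hypothesis hD : simplicial_complex D.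
Hypothesis rD : r \in vertices D.
Local Notation X := (@realization R V D).
Local Notation pt := (@vertex_point R V).
Local Notation clamp := (@clamp R).
Local Notation loop := (loop X (pt r)).
Local Notation loop_homotopic := (loop_homotopic X (pt r)).
Local Notation loop_class := (loop_class X (pt r)).

(** Some coordinate reaches the mean. The bound is the same for all points, which allows one mesh
    for a whole loop. *)
Lemma large_coordinate (x : 'rV[R]_#|V|) : X x ->
  exists v, (#|V|%:R)^-1 <= x ord0 (enum_rank v).
Proof.
case=> _ x1 _; apply: contrapT => /forallNP small.
suff : \sum_j x ord0 j < \sum_(j < #|V|) (#|V|%:R)^-1.
  rewrite x1 sumr_const card_ord -[_ *+ _]mulr_natr mulVf ?ltxx //.
  by rewrite pnatr_eq0 -lt0n; apply/card_gt0P; exists r.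
apply: ltr_sum.
  by apply/hasP; exists (enum_rank r); rewrite ?mem_index_enum.
move=> j _; have := small (enum_val j).
by rewrite enum_valK => /negP; rewrite -ltNge.
Qed.

Lemma loop_walk f : loop f ->
  exists2 p, closed_walk D r p & loop_homotopic f (walk_loop r p).
Proof.
move=> lf; have [_ _ f0 f1] := lf.
pose g t := f (clamp t).
have cg : continuous g by exact: (loop_continuous lf).
have Xg t : X (g t) by exact: (loop_sub_clamp t lf).
have g0 : g 0 = pt r by rewrite /g clamp_le0.
have g1 : g 1 = pt r by rewrite /g clamp_ge1.
have V0 : 0 < (#|V|%:R)^-1 :> R.
  by rewrite invr_gt0 ltr0n; apply/card_gt0P; exists r.
have [d d0 unif] := uniform_continuity_unit cg V0.
have [N N0 Nd] : exists2 N : nat, (0 < N)%N & (N%:R)^-1 < d.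
  have dV : 0 < d^-1 by rewrite invr_gt0.
  have dN : d^-1 < (Num.bound d^-1)%:R by apply: archi_boundP; exact: ltW.
  have N0 : (0 : R) < (Num.bound d^-1)%:R by exact: lt_trans dN.
  exists (Num.bound d^-1); first by rewrite ltr0n in N0.
  by rewrite -[X in _ < X]invrK ltf_pV2.
have NR0 : 0 < N%:R :> R by rewrite ltr0n.
(* At samples equal to the base point [r] is chosen outright, which closes up the walk. *)
have /choice[w hw] : forall i : nat, exists v,
    (#|V|%:R)^-1 <= g (i%:R / N%:R) ord0 (enum_rank v) /\
    (g (i%:R / N%:R) = pt r -> v = r).
  move=> i; have [gi|gi] := pselect (g (i%:R / N%:R) = pt r).
    exists r; split=> //; rewrite gi pt_entry eqxx.
    by rewrite invf_le1 ?ler1n ?ltr0n; apply/card_gt0P; exists r.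
  by have [v hv] := large_coordinate (Xg (i%:R / N%:R)); exists v.
have near_w i t : 0 <= t <= 1 -> `|t - i%:R / N%:R| <= (N%:R)^-1 ->
    w i \in support_set (g t).
  move=> t01 ti; have [wi _] := hw i.
  have := unif t (i%:R / N%:R) t01 (le_lt_trans ti Nd) (enum_rank (w i)).
  rewrite inE => h; apply/eqP => gt0; move: h; rewrite gt0 sub0r normrN.
  by rewrite ger0_norm ?(le_trans (ltW V0)) // ltNge wi.
have w0 : w 0%N = r by apply: (hw 0%N).2; rewrite mul0r.
have wN : w N = r by apply: (hw N).2; rewrite mulfV ?gt_eqF.
pose p := mkseq (fun i => w i.+1) N.
have sp : size p = N by rewrite size_mkseq.
have nthp i : (i <= N)%N -> nth r (r :: p) i = w i.
  by case: i => [|i] iN //=; rewrite nth_mkseq.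
have frac i (t : R) : i%:R <= N%:R * t -> N%:R * t <= i.+1%:R ->
    `|t - i%:R / N%:R| <= (N%:R)^-1 /\ `|t - i.+1%:R / N%:R| <= (N%:R)^-1.
  rewrite -natr1 => h1 h2.
  have -> : t = N%:R * t / N%:R by rewrite mulrC mulKf ?gt_eqF.
  rewrite -!mulrBl !normrM (gtr0_norm (x := N%:R^-1)) ?invr_gt0 //.
  by split; apply: ler_piMl; rewrite ?invr_ge0 ?ler0n // ler_norml; lra.
have wp : closed_walk D r p.
  apply/andP; split; last first.
    by rewrite (last_nth r) sp nthp // wN.
  apply/(pathP r) => i; rewrite sp => iN; rewrite nthp ?(ltnW iN) //.
  rewrite nth_mkseq //.
  have i01 : 0 <= (i%:R / N%:R : R) <= 1.
    by rewrite divr_ge0 ?ler0n //= ler_pdivrMr // mul1r ler_nat ltnW.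
  have [||h1 h2] := frac i (i%:R / N%:R).
  - by rewrite mulrC divfK ?gt_eqF.
  - by rewrite mulrC divfK ?gt_eqF // ler_nat.
  (* Both vertices lie in the support of the same sample, which is a face. *)
  have [_ _ gD] := Xg (i%:R / N%:R).
  apply: hD gD _; apply/fintype.subsetP => v; rewrite !inE => /orP[]/eqP ->.
    by have := near_w _ _ i01 h1; rewrite inE.
  by have := near_w _ _ i01 h2; rewrite inE.
exists p => //; case/andP: (wp) => pp _.
apply: (@homotopic_trans _ _ _ _ g).
  by apply: homotopic_eq => // t t01; rewrite /g clamp_id.
have [_ _ l0 l1] := walk_loop_loop R hD rD wp.
apply: straight_line_homotopic => //.
- exact: walk_loop_continuous.
- by move=> t _; exact: polyline_realization.
move=> t t01.
have [] := @polyline_segment R V r p ((size p)%:R * t).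
- by rewrite sp; nra.
- by rewrite sp.
move=> i [iN it ti [s hs]]; rewrite sp in iN it ti.
have [h1 h2] := frac i t it ti.
(* Time [t] lies between two consecutive samples and is within one mesh of both, so both chosen
   vertices are in the support of [g t]. *)
exists (support_set (g t)); split=> //; first by case: (Xg t).
rewrite /walk_loop hs !nthp ?(ltnW iN) //.
by apply: support_set_segment; exact: near_w.
Qed.

Lemma pi1_rank_le (k : nat) (gen : 'I_k -> seq V) :
  (forall i, closed_walk D r (gen i)) ->
  (forall G : seq V -> Prop, G [::] ->
    (forall p q, closed_walk D r p -> closed_walk D r q ->
      G p -> G q -> G (p ++ q)) ->
    (forall p, closed_walk D r p -> G p -> G (rev_walk r p)) ->
    (forall p q, closed_walk D r p -> walk_eq D r p q -> G p -> G q) ->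
    (forall i, G (gen i)) ->
    forall p, closed_walk D r p -> G p) ->
  (pi1_rank R X (pt r) <= (k%:R)%:E)%E.
Proof.
move=> wgen hgen; apply: ereal_inf_lbound; exists k => //=.
exists (fun i => loop_class (walk_loop r (gen i))); split.
  by move=> _ [i _ <-]; exists (walk_loop r (gen i)) => //; exact: walk_loop_loop.
move=> G [sG G1 GM GV] genG; apply/seteqP; split=> // _ [f lf <-].
have [p wp /loop_class_eq ->] := loop_walk lf.
(* The loop of the empty walk is constant by computation, so [G1] settles the empty case. *)
apply: (hgen (fun q => G (loop_class (walk_loop r q)))) => //.
- move=> q q' wq wq' Gq Gq'.
  rewrite -(loop_class_eq (walk_loop_cat R hD rD wq wq')).
  rewrite -pi1_mul_class; first exact: GM.
    exact: walk_loop_loop.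
  exact: walk_loop_loop.
- move=> q wq Gq; rewrite -(walk_loop_rev R wq) -pi1_inv_class; first exact: GV.
  exact: walk_loop_loop.
- move=> q q' wq qq'.
  by rewrite (loop_class_eq (walk_eq_homotopic R hD rD qq' wq)).
- by move=> i; apply: genG; exists i.
Qed.

End Approximation.

(** * The bound for one ordering and its average *)

Lemma m_number_le (R : realType) (F : fieldType) (V : finType)
    (D : {set {set V}}) (s : #|V|.-tuple V) :
  simplicial_complex D -> uniq s ->
  (m_number R D <=
    ((mu_order F s D 1)%:R - (mu_order F s D 0)%:R + (b0 D)%:R)%:E)%E.
Proof.
move=> hD us.
pose bounds r (n : nat) := r \in vertices D ->
  (n + #|[set v | connect (edge D) r v]%SET| =
    #|[set x in kept_pairs D s | connect (edge D) r x.1]%SET|.+1)%N /\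
  (pi1_rank R (realization (component D r)) (vertex_point R r) <= (n%:R)%:E)%E.
have [k hk] : exists k : V -> nat, forall r, bounds r (k r).
  apply: fin_all_exists => r.
  case: (boolP (r \in vertices D)) => rD; last by exists 0%N; rewrite /bounds (negPf rD).
  have [k [gen [ck cgen hgen]]] := component_generators hD (mem_uniq_tuple us) rD.
  exists k => _; split=> //; apply: pi1_rank_le hgen => //.
    exact: simplicial_induced.
  by rewrite (vertices_component hD rD).
have cK := sum_component_generators hD (mem_uniq_tuple us) (fun r rD => (hk r rD).1).
have cmu := kept_pairs_mu F hD us.
apply: (@le_trans _ _ (\sum_(r in [predI roots (edge D) & vertices D])
    ((k r)%:R)%:E)%E).
  by apply: lee_sum => r /andP[_ rD]; exact: (hk r rD).2.
rewrite sumEFin -natr_sum lee_fin; set K := (\sum_(r in _) k r)%N in cK *.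
have : (K + mu_order F s D 0 <= mu_order F s D 1 + b0 D)%N.
  by rewrite -(leq_add2r #|vertices D|) addnAC cK addnAC [leqRHS]addnAC leq_add2r.
by rewrite -(ler_nat R) !natrD; lra.
Qed.

Theorem theorem3p3 (R : realType) (F : fieldType) (V : finType)
    (D : {set {set V}}) (hD : simplicial_complex D) :
  (forall s : #|V|.-tuple V, uniq s ->
     (m_number R D - ((b0 D)%:R)%:E <=
      ((mu_order F s D 1)%:R - (mu_order F s D 0)%:R)%:E)%E) /\
  (connected_complex D ->
     (m_number R D <= (mu R F D 1 - mu R F D 0 + 1)%R%:E)%E).
Proof.
split=> [s us|cD].
  by rewrite leeBlDr // -EFinD; exact: m_number_le.
(* An inequality, because a complex without vertices counts as connected and has [b0 D = 0]. *)
have b1 : ((b0 D)%:R <= 1 :> R) by rewrite lern1; exact: b0_connected.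
have le_s (s : #|V|.-tuple V) : uniq s -> (m_number R D <=
    ((mu_order F s D 1)%:R - (mu_order F s D 0)%:R + 1)%:E)%E.
  move=> us; apply: le_trans (m_number_le R F hD us) _.
  by rewrite lee_fin lerD2l.
case: (m_number R D) le_s => [m| |] le_s; last by rewrite leNye.
  have n0 : (0 : R) < ((#|V|)`!)%:R by rewrite ltr0n fact_gt0.
  have sum1 : ((#|V|)`!)%:R = \sum_(s : #|V|.-tuple V | uniq s) (1 : R).
    rewrite -card_orderings -sum1_card natr_sum.
    by apply: eq_bigl => s; rewrite inE.
  (* After multiplication by the factorial, the claim is the sum of the bounds over all
     orderings. *)
  rewrite lee_fin /mu -mulrBr -sumrB -(ler_pM2l n0) mulrDr mulrA mulfV ?gt_eqF //.
  rewrite mul1r mulr1 sum1 mulr_suml -big_split /=.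
  by apply: ler_sum => s us; rewrite mul1r; have := le_s s us; rewrite lee_fin.
(* An infinite [m_number] contradicts the finite bound from any one ordering, here the enumeration
   of [V]. *)
have us : uniq (enum V) by exact: enum_uniq.
have szV : size (enum V) == #|V| by rewrite -cardE.
by have := le_s (Tuple szV) us; rewrite leye_eq.
Qed.
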